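(* Let $f_1,\ldots,f_{m+2}$ be SOS-convex semi-algebraic functions on $\mathbb{R}^n$ given with representations as in the context, such that $K:=\{x\in\mathbb{R}^n : f_i(x)\le 0,\ i=1,\ldots,m\}$ is nonempty and $f_{m+1}(x)\ge 0$, $-f_{m+2}(x)>0$ for all $x\in K$. Suppose that: (1) the convex cone $$\mathcal{C}:=\bigcup_{y^{i}\in\Omega_{i},\,\lambda_{i}\geq 0,\ i=1,\ldots,m}\mathrm{epi}\Big(\sum_{i=1}^m\lambda_{i}\Big(h_{0}^{i}+\sum_{j=1}^{s_{i}}y^{i}_{j}h^{i}_{j}\Big)\Big)^*\subseteq\mathbb{R}^n\times\mathbb{R}$$ is closed; and (2) for each $i\in I=\{1,\ldots,m+2\}$ there exist $\hat y^i\in\mathbb{R}^{s_i}$ and $\hat z^i\in\mathbb{R}^{p_i}$ such that $A_0^i+\sum_{j=1}^{s_i}\hat y_j^iA_j^i+\sum_{\ell=1}^{p_i}\hat z_\ell^iB_\ell^i\succ 0$. Then $$\inf(\mathrm{FP})=\sup(\widehat{\mathrm{Q}})=\inf(\mathrm{Q}),$$ where $(\mathrm{FP})$, $(\widehat{\mathrm{Q}})$ and $(\mathrm{Q})$ are the problems defined in the context. Moreover, if $(\overline y,\overline Z_1,\ldots,\overline Z_{m+2})$ is an optimal solution of $(\mathrm{Q})$ with $\overline y_0\neq 0$ (where $\overline y_0$ is the component of $\overline y$ indexed by $\alpha=0$), then $$\overline x:=\frac{1}{\overline y_0}\big(L_{\overline y}(x_1),\ldots,L_{\overline y}(x_n)\big)$$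 is an optimal solution of $(\mathrm{FP})$.
   Context: **Notation.** $\mathbb{N}$ is the set of non-negative integers. For $\alpha\in\mathbb{N}^n$, $|\alpha|=\sum_i\alpha_i$, $x^\alpha=x_1^{\alpha_1}\cdots x_n^{\alpha_n}$, and $\mathbb{N}^n_{k}=\{\alpha\in\mathbb{N}^n: |\alpha|\le k\}$. $s(k)=\binom{n+k}{n}$. $S^k$ is the space of real symmetric $k\times k$ matrices, $\langle X,Y\rangle=\mathrm{tr}(XY)$, $X\succeq 0$ (resp. $X\succ 0$) means $X$ is positive semidefinite (resp. positive definite). $v_d(x)=(x^\alpha)_{\alpha\in\mathbb{N}^n_d}$ is the column vector of monomials of degree at most $d$, and the matrices $\mathcal{B}_\alpha\in S^{s(d)}$, $\alpha\in\mathbb{N}^n_{2d}$, are defined by $v_d(x)v_d(x)^T=\sum_{\alpha\in\mathbb{N}^n_{2d}}x^\alpha\mathcal{B}_\alpha$. For a polynomial $h$ of degree at most $2d$, $(h)_\alpha$ is its coefficient of $x^\alpha$. For $y=(y_\alpha)_{\alpha\in\mathbb{N}^n_{2d}}\in\mathbb{R}^{s(2d)}$, $L_y$ is the linear functional $L_y(h)=\sum_{\alpha\in\mathbb{N}^n_{2d}}(h)_\alpha y_\alpha$ on polynomials of degree at most $2d$; in particular $L_y(x_k)$ is the entry of $y$ indexed by the exponent of the monomial $x_k$. For a function $\phi:\mathbb{R}^n\to\mathbb{R}\cup\{+\infty\}$, $\phi^*(x^* )=\sup_{x\in\mathbb{R}^n}\{\langle x^*,x\rangle-\phi(x)\}$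 is its conjugate and $\mathrm{epi}\,\phi=\{(x,r)\in\mathbb{R}^n\times\mathbb{R}:\phi(x)\le r\}$ its epigraph. **SOS-convexity.** A real polynomial $f$ on $\mathbb{R}^n$ is SOS-convex if there is a matrix polynomial $F(x)$ with $\nabla^2 f(x)=F(x)F(x)^T$. **Data.** Let $I=\{1,\ldots,m+2\}$. For each $i\in I$, $$f_i(x)=\sup_{(y^i_1,\ldots,y^i_{s_i})\in\Omega_i}\Big\{h_0^i(x)+\sum_{j=1}^{s_i}y_j^ih_j^i(x)\Big\},$$ where (a) each $h_j^i$, $j=0,\ldots,s_i$, is a polynomial on $\mathbb{R}^n$ of degree at most $2d$, and for each $y^i\in\Omega_i$ the polynomial $h_0^i+\sum_{j=1}^{s_i}y_j^ih_j^i$ is SOS-convex; (b) $\Omega_i$ is a nonempty compact set of the form $$\Omega_i=\Big\{(y_1^i,\ldots,y_{s_i}^i)\in\mathbb{R}^{s_i}:\exists z^i\in\mathbb{R}^{p_i}\ \text{s.t.}\ A_0^i+\sum_{j=1}^{s_i}y_j^iA_j^i+\sum_{\ell=1}^{p_i}z_\ell^iB_\ell^i\succeq 0\Big\},$$ with $A_j^i$, $j=0,\ldots,s_i$, and $B_\ell^i$, $\ell=1,\ldots,p_i$, symmetric $t_i\times t_i$ matrices. (Such functions $f_i$ are called SOS-convex semi-algebraic.) **Fractional program.** $$(\mathrm{FP})\qquad \inf_{x\in\mathbb{R}^n}\Big\{\frac{f_{m+1}(x)}{-f_{m+2}(x)} : f_i(x)\le 0,\ i=1,\ldots,m\Big\}.$$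 **SDP relaxation dual problem.** $$(\widehat{\mathrm{Q}})\qquad \sup_{\lambda_j^i,\,z_\ell^i,\,X}\ \lambda_0^{m+2}$$ subject to $$\sum_{i=1}^{m+2}\Big(\lambda_0^i(h_0^i)_\alpha+\sum_{j=1}^{s_i}\lambda_j^i(h_j^i)_\alpha\Big)=\langle\mathcal{B}_\alpha,X\rangle,\quad \alpha\in\mathbb{N}^n_{2d},$$ $$\lambda_0^iA_0^i+\sum_{j=1}^{s_i}\lambda_j^iA_j^i+\sum_{\ell=1}^{p_i}z_\ell^iB_\ell^i\succeq 0,\quad i=1,\ldots,m+2,$$ $$\lambda_0^{m+1}=1,\quad \lambda_0^i\ge 0\ (i=1,\ldots,m,m+2),\quad X\in S^{s(d)},\ X\succeq 0,$$ $$\lambda_j^i\in\mathbb{R},\ z_\ell^i\in\mathbb{R},\quad i\in I,\ j=1,\ldots,s_i,\ \ell=1,\ldots,p_i.$$ **Lagrangian dual of $(\widehat{\mathrm{Q}})$.** $$(\mathrm{Q})\qquad \inf_{y\in\mathbb{R}^{s(2d)},\ Z_i\in S^{t_i},\,Z_i\succeq 0,\ i\in I}\ \sum_{\alpha\in\mathbb{N}^n_{2d}}(h_0^{m+1})_\alpha y_\alpha+\langle A_0^{m+1},Z_{m+1}\rangle$$ subject to $$1+\sum_{\alpha\in\mathbb{N}^n_{2d}}(h_0^{m+2})_\alpha y_\alpha+\langle A_0^{m+2},Z_{m+2}\rangle\le 0,$$ $$\sum_{\alpha\in\mathbb{N}^n_{2d}}(h_0^i)_\alpha y_\alpha+\langle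 A_0^i,Z_i\rangle\le 0,\quad i=1,\ldots,m,$$ $$\sum_{\alpha\in\mathbb{N}^n_{2d}}(h_j^i)_\alpha y_\alpha+\langle A_j^i,Z_i\rangle=0,\quad i\in I,\ j=1,\ldots,s_i,$$ $$\langle B_\ell^i,Z_i\rangle=0,\quad i\in I,\ \ell=1,\ldots,p_i,$$ $$\sum_{\alpha\in\mathbb{N}^n_{2d}}y_\alpha\mathcal{B}_\alpha\succeq 0.$$ *)

(* Defs.v *)
From HB Require Import structures.
From mathcomp Require Import all_boot all_order all_algebra.
(* [mpoly] must be imported before the mathcomp-analysis files: in the other
   order their notations clash. *)
From mathcomp Require Import mpoly.
From mathcomp Require Import boolp classical_sets reals ereal topology.
From mathcomp Require Import normedtype.

Set Implicit Arguments.
Unset Strict Implicit.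
Unset Printing Implicit Defensive.

Import Order.TTheory GRing.Theory Num.Theory.
Import numFieldNormedType.Exports.

Local Open Scope classical_set_scope.
Local Open Scope ring_scope.

(* The finite type of exponents alpha in N^n with |alpha| <= k. *)
Notation expo n k := 'X_{1..n < k.+1}.

Section Matrices.
Context {R : realType}.

Definition mxinner k (X Y : 'M[R]_k) : R := \tr (X *m Y).

Definition psdmx k (X : 'M[R]_k) : Prop :=
  X \is symmetricmx /\ forall v : 'cV[R]_k, 0 <= (v^T *m X *m v) ord0 ord0.

Definition pdmx k (X : 'M[R]_k) : Prop :=
  X \is symmetricmx /\
  forall v : 'cV[R]_k, v != 0 -> 0 < (v^T *m X *m v) ord0 ord0.

End Matrices.

Section Polynomials.
Context {R : realType} {n : nat}.

Definition peval (p : {mpoly R[n]}) (x : 'rV[R]_n) : R := p.@[x ord0].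

Definition hessian (p : {mpoly R[n]}) : 'M[{mpoly R[n]}]_n :=
  \matrix_(i, j) p^`M(i)^`M(j).

Definition sos_convex (p : {mpoly R[n]}) : Prop :=
  exists (r : nat) (F : 'M[{mpoly R[n]}]_(n, r)), hessian p = F *m F^T.

(* Rows are indexed by [enum_val] on the exponents; the particular order of
   the monomials is immaterial. *)
Definition monvec (d : nat) : 'cV[{mpoly R[n]}]_#|{: expo n d}| :=
  \col_(i < #|{: expo n d}|) 'X_[R, (enum_val i : expo n d)].

(* B_alpha is the matrix coefficient of x^alpha in v_d(x) v_d(x)^T. *)
Definition Bmx (d : nat) (a : expo n (2 * d)) : 'M[R]_#|{: expo n d}| :=
  map_mx (mcoeff a) (monvec d *m (monvec d)^T).

(* L_y, for p of degree at most k. *)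
Definition Lfun (k : nat) (y : {ffun expo n k -> R}) (p : {mpoly R[n]}) : R :=
  \sum_(a : expo n k) p@_a * y a.

End Polynomials.

Section Functions.
Context {R : realType} {n : nat}.

Definition conjugate (phi : 'rV[R]_n -> \bar R) (u : 'rV[R]_n) : \bar R :=
  ereal_sup
    [set ((\sum_(k < n) u ord0 k * x ord0 k)%:E - phi x)%E | x in [set: 'rV[R]_n]].

Definition epi (phi : 'rV[R]_n -> \bar R) : set ('rV[R]_n * R) :=
  [set q | (phi q.1 <= q.2%:E)%E].

End Functions.

(* The data (h_j), (A_j), (B_l) representing an SOS-convex semi-algebraic
   function; [h0], [A0] have index j = 0 and [hcoef], [Acoef] the indices
   j = 1, .., s. *)
Record sossa_data (R : realType) (n : nat) := SossaData {
  sdim : nat;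
  pdim : nat;
  tdim : nat;
  h0 : {mpoly R[n]};
  hcoef : 'I_sdim -> {mpoly R[n]};
  A0 : 'M[R]_tdim;
  Acoef : 'I_sdim -> 'M[R]_tdim;
  Bcoef : 'I_pdim -> 'M[R]_tdim
}.

Arguments hcoef {R n} s.
Arguments Acoef {R n} s.
Arguments Bcoef {R n} s.

Section SossaFunctions.
Context {R : realType} {n : nat}.
Implicit Type D : sossa_data R n.

Definition lmi D (y : 'rV[R]_(sdim D)) (z : 'rV[R]_(pdim D)) : 'M[R]_(tdim D) :=
  A0 D + \sum_j y ord0 j *: Acoef D j + \sum_l z ord0 l *: Bcoef D l.

Definition Omega D : set 'rV[R]_(sdim D) :=
  [set y | exists z : 'rV[R]_(pdim D), psdmx (lmi y z)].
Arguments Omega D _ : clear implicits.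

Definition hpoly D (y : 'rV[R]_(sdim D)) : {mpoly R[n]} :=
  h0 D + \sum_j y ord0 j *: hcoef D j.

(* [sup] is the true supremum for data satisfying [sossa_ok]: the set is then
   nonempty and bounded. *)
Definition sossa_fun D (x : 'rV[R]_n) : R :=
  sup [set peval (hpoly y) x | y in Omega D].

(* [msize p] is 1 + the total degree of p (0 for p = 0). *)
Definition sossa_ok (d : nat) D : Prop :=
  [/\ (msize (h0 D) <= (2 * d).+1)%N /\
        (forall j, (msize (hcoef D j) <= (2 * d).+1)%N),
      (forall y, Omega D y -> sos_convex (hpoly y)),
      [/\ A0 D \is symmetricmx, (forall j, Acoef D j \is symmetricmx) &
          (forall l, Bcoef D l \is symmetricmx)],
      Omega D !=set0 &
      compact (Omega D)].

End SossaFunctions.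
Arguments Omega {R n} D _.

Definition is_minimizer (R : realType) (T : Type) (S : set T) (g : T -> R) (x : T)
  : Prop := S x /\ forall x', S x' -> g x <= g x'.

Section FractionalProgram.
Context {R : realType} {n : nat} (d m : nat).
Variable f : 'I_(m + 2) -> sossa_data R n.

(* The index set {1, .., m+2}: constraints, numerator m+1, denominator m+2. *)
Definition cix (i : 'I_m) : 'I_(m + 2) := lshift 2 i.
Definition numix : 'I_(m + 2) := rshift m (ord0 : 'I_2).
Definition denix : 'I_(m + 2) := rshift m (ord_max : 'I_2).

Definition FPset : set 'rV[R]_n :=
  [set x | forall i : 'I_m, sossa_fun (f (cix i)) x <= 0].

Definition FPobj (x : 'rV[R]_n) : R :=
  sossa_fun (f numix) x / - sossa_fun (f denix) x.

Definition infFP : \bar R := ereal_inf [set (FPobj x)%:E | x in FPset].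

Definition epicone : set ('rV[R]_n * R) :=
  [set q | exists (y : forall i : 'I_m, 'rV[R]_(sdim (f (cix i))))
                  (lam : 'I_m -> R),
     [/\ forall i, Omega (f (cix i)) (y i), forall i, 0 <= lam i &
         epi (conjugate
                (fun x => (peval (\sum_i lam i *: hpoly (y i)) x)%:E)) q]].

Definition Qhatfeas (lam0 : 'I_(m + 2) -> R)
    (lam : forall i, 'rV[R]_(sdim (f i))) (z : forall i, 'rV[R]_(pdim (f i)))
    (X : 'M[R]_#|{: expo n d}|) : Prop :=
  [/\ forall a : expo n (2 * d),
        \sum_i (lam0 i * (h0 (f i))@_a +
                \sum_j lam i ord0 j * (hcoef (f i) j)@_a)
        = mxinner (Bmx a) X,
      forall i, psdmx (lam0 i *: A0 (f i) +
                       \sum_j lam i ord0 j *: Acoef (f i) j +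
                       \sum_l z i ord0 l *: Bcoef (f i) l),
      lam0 numix = 1,
      (forall i : 'I_m, 0 <= lam0 (cix i)) /\ 0 <= lam0 denix &
      psdmx X].

Definition supQhat : \bar R :=
  ereal_sup [set v | exists lam0 lam z X,
    Qhatfeas lam0 lam z X /\ v = (lam0 denix)%:E].

Definition Qfeas (y : {ffun expo n (2 * d) -> R})
    (Z : forall i, 'M[R]_(tdim (f i))) : Prop :=
  [/\ forall i, psdmx (Z i),
      1 + Lfun y (h0 (f denix)) + mxinner (A0 (f denix)) (Z denix) <= 0,
      forall i : 'I_m,
        Lfun y (h0 (f (cix i))) + mxinner (A0 (f (cix i))) (Z (cix i)) <= 0,
      (forall i j, Lfun y (hcoef (f i) j) + mxinner (Acoef (f i) j) (Z i) = 0) /\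
      (forall i l, mxinner (Bcoef (f i) l) (Z i) = 0) &
      psdmx (\sum_(a : expo n (2 * d)) y a *: Bmx a)].

Definition Qvar : Type :=
  ({ffun expo n (2 * d) -> R} * (forall i, 'M[R]_(tdim (f i))))%type.

Definition Qset : set Qvar := [set w : Qvar | Qfeas w.1 w.2].

Definition Qobj (w : Qvar) : R :=
  Lfun w.1 (h0 (f numix)) + mxinner (A0 (f numix)) (w.2 numix).

Definition infQ : \bar R := ereal_inf [set (Qobj w)%:E | w in Qset].

End FractionalProgram.

(* Main.v *)
(* Weak conic duality gives sup(Qhat) <= inf(Q).  Slater's condition makes the
   semidefinite dual of the supremum defining each f_i attained, so that a
   feasible x of (FP), with its monomials scaled by 1 / - f_{m+2}(x), extends to
   a feasible point of (Q) of the same value: inf(Q) <= inf(FP).  For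
   inf(FP) <= sup(Qhat), let theta := inf(FP).  As C is closed and the Omega_i
   are compact, separating 0 from the sum of C and the epigraphs of the
   conjugates of h^{m+1}_y + theta h^{m+2}_y' produces maximizing parameters
   and multipliers for which the Lagrangian is a nonnegative SOS-convex
   polynomial.  Jensen's inequality for SOS-convex polynomials,
   y_0 h(L(x) / y_0) <= L(h) whenever L is nonnegative on squares, shows that
   it is nonnegative under every such functional L, hence a sum of squares,
   because the cone of sums of squares of bounded degree is closed.  The same
   inequality gives the recovery of a minimizer of (FP). *)

From HB Require Import structures.
Require Import Defs.
From mathcomp Require Import all_boot all_order all_algebra.
From mathcomp Require Import mpoly.
From mathcomp Require Import boolp classical_sets reals ereal topology.
From mathcomp Require Import normedtype derive.
From mathcomp Require Import polyrcf.
From mathcomp Require Import ring lra.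

Set Implicit Arguments.
Unset Strict Implicit.
Unset Printing Implicit Defensive.

Import Order.TTheory GRing.Theory Num.Theory.
Import numFieldNormedType.Exports.
Local Open Scope classical_set_scope.
Local Open Scope ring_scope.

(** * Positive semidefinite matrices *)

(** The infimum of (FP) need not be attained and no point with all f_i(x) < 0 is assumed, so
    multipliers cannot be read off at a minimizer. The fraction disappears because a lower bound
    theta on the ratio means f_{m+1} + theta f_{m+2} >= 0 on K; the sign conditions give theta >= 0,
    which keeps theta h^{m+2} SOS-convex. The set to be separated from 0 is a sum of unbounded sets,
    and such sums need not be closed: a point of K bounds the cone part from one side, and the
    polynomials, finite everywhere, bound the epigraph part. Jensen's inequality comes from one
    variable: applying L to the coefficients of h(c + t (x - c)) gives a real polynomial in t whose
    second derivative is L of a sum of squares. A functional nonnegative on squares may have y_0 =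
    0, where no barycentre exists; a small multiple of a point evaluation repairs this. One
    semidefinite Farkas lemma yields both the Gram matrices and the attained duals of the f_i; its
    closedness hypothesis comes from the non-cancellation of squares in one case and from Slater's
    condition in the other. *)

Section PsdMatrices.
Context {R : realType}.

Lemma symmetricmxP k (X : 'M[R]_k) : reflect (X^T = X) (X \is symmetricmx).
Proof.
rewrite is_hermitianmxE expr0 scale1r map_mx_id //.
by apply: (iffP eqP) => [<-|->].
Qed.

Lemma mxinnerC k (X Y : 'M[R]_k) : mxinner X Y = mxinner Y X.
Proof. exact: mxtrace_mulC. Qed.

Lemma mxinnerDr k (X Y Z : 'M[R]_k) :
  mxinner X (Y + Z) = mxinner X Y + mxinner X Z.
Proof. by rewrite /mxinner mulmxDr linearD. Qed.

Lemma mxinnerZr k a (X Y : 'M[R]_k) : mxinner X (a *: Y) = a * mxinner X Y.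
Proof. by rewrite /mxinner -scalemxAr linearZ. Qed.

Lemma mxinnerDl k (X Y Z : 'M[R]_k) :
  mxinner (X + Y) Z = mxinner X Z + mxinner Y Z.
Proof. by rewrite !(mxinnerC _ Z) mxinnerDr. Qed.

Lemma mxinnerZl k a (X Y : 'M[R]_k) : mxinner (a *: X) Y = a * mxinner X Y.
Proof. by rewrite !(mxinnerC _ Y) mxinnerZr. Qed.

Lemma mxinner_suml k (I : finType) (X : I -> 'M[R]_k) Y :
  mxinner (\sum_i X i) Y = \sum_i mxinner (X i) Y.
Proof. by rewrite /mxinner mulmx_suml linear_sum. Qed.

Lemma mxinner_rank1 k (X : 'M[R]_k) (v : 'cV[R]_k) :
  mxinner X (v *m v^T) = (v^T *m X *m v) ord0 ord0.
Proof. by rewrite /mxinner mulmxA mxtrace_mulC mulmxA /mxtrace big_ord1. Qed.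

Lemma mxinner_gram k r (X : 'M[R]_k) (G : 'M[R]_(k, r)) :
  mxinner X (G *m G^T) =
  \sum_j ((col j G)^T *m X *m col j G) ord0 ord0.
Proof.
rewrite /mxinner mulmxA mxtrace_mulC mulmxA /mxtrace; apply: eq_bigr => j _.
by rewrite tr_col -!row_mul !mxE; apply: eq_bigr => i _; rewrite !mxE.
Qed.

Lemma psdmx_rank1 k (v : 'cV[R]_k) : psdmx (v *m v^T).
Proof.
split=> [|w]; first by apply/symmetricmxP; rewrite trmx_mul trmxK.
have -> : w^T *m (v *m v^T) *m w = (v^T *m w)^T *m (v^T *m w).
  by rewrite trmx_mul trmxK !mulmxA.
by rewrite !mxE big_ord1 !mxE -expr2 sqr_ge0.
Qed.

Lemma psdmx0 k : psdmx (0 : 'M[R]_k).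
Proof.
split=> [|w]; first by apply/symmetricmxP; rewrite trmx0.
by rewrite mulmx0 mul0mx mxE.
Qed.

Lemma psdmxD k (X Y : 'M[R]_k) : psdmx X -> psdmx Y -> psdmx (X + Y).
Proof.
move=> [/symmetricmxP sX pX] [/symmetricmxP sY pY]; split=> [|w].
  by apply/symmetricmxP; rewrite linearD /= sX sY.
by rewrite mulmxDr mulmxDl mxE addr_ge0.
Qed.

Lemma psdmxZ k a (X : 'M[R]_k) : 0 <= a -> psdmx X -> psdmx (a *: X).
Proof.
move=> a0 [/symmetricmxP sX pX]; split=> [|w].
  by apply/symmetricmxP; rewrite linearZ /= sX.
by rewrite -scalemxAr -scalemxAl mxE mulr_ge0.
Qed.

Lemma pdmx_psd k (X : 'M[R]_k) : pdmx X -> psdmx X.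
Proof.
move=> [sX pX]; split=> // v; have [->|/pX/ltW//] := eqVneq v 0.
by rewrite mulmx0 mxE.
Qed.

(* Cholesky: eliminate the first row and column; a vanishing pivot forces a
   vanishing column. *)
Lemma psdmx_gram k (Z : 'M[R]_k) :
  psdmx Z -> exists G : 'M[R]_k, Z = G *m G^T.
Proof.
elim: k Z => [|k IH] Z; first by exists 0; rewrite [Z]flatmx0 mul0mx.
rewrite -[k.+1]/(1 + k)%N in Z *.
move=> [/symmetricmxP sZ pZ].
pose a := Z ord0 ord0; pose b := dlsubmx Z; pose C := drsubmx Z.
have eZ : Z = block_mx a%:M b^T b C.
  rewrite -[LHS]submxK; congr block_mx.
    by apply/matrixP=> i j; rewrite !ord1 !mxE; congr (Z _ _); apply: val_inj.
  by rewrite /b trmx_dlsub sZ.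
have sC : C^T = C by rewrite /C trmx_drsub sZ.
have q (s : R) (w : 'cV[R]_k) :
    0 <= s ^+ 2 * a + 2 * s * (b^T *m w) ord0 ord0
         + (w^T *m C *m w) ord0 ord0.
  have := pZ (col_mx (s%:M : 'cV_1) w).
  rewrite {1}eZ tr_col_mx mul_row_block mul_row_col !mulmxDl.
  have -> : w^T *m b *m s%:M = s *: (b^T *m w)^T.
    by rewrite trmx_mul trmxK; exact: mul_mx_scalar.
  rewrite tr_scalar_mx -scalar_mxM (mul_scalar_mx s b^T) -scalemxAl.
  rewrite -(scalar_mxM _ (s * a)).
  rewrite !mxE eqxx mulr1n; move: (\sum_j _) (\sum_j _) => t u h; lra.
have a0 : 0 <= a by have := q 1 0; rewrite !mulmx0 !mxE => h; lra.
have b0 : a = 0 -> b = 0.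
  move=> a_0; apply/colP=> i; rewrite [RHS]mxE; apply/eqP/negPn/negP => bi0.
  pose e : 'cV[R]_k := delta_mx i ord0.
  pose c := (e^T *m C *m e) ord0 ord0.
  have be : (b^T *m e) ord0 ord0 = b i ord0.
    by rewrite -colE [LHS]mxE [LHS]mxE.
  (* The first coordinate is chosen to make the cross term equal to -(c + 1), so the form takes the
     value -1. *)
  have := q (- (c + 1) / (2 * b i ord0)) e.
  rewrite a_0 be -/c mulr0 add0r.
  have -> : 2 * (- (c + 1) / (2 * b i ord0)) * b i ord0 = - (c + 1) by field.
  by lra.
have [G' eG'] : exists G' : 'M_k, C - a^-1 *: (b *m b^T) = G' *m G'^T.
  apply: IH; split=> [|w].
    by apply/symmetricmxP; rewrite linearB linearZ /= trmx_mul trmxK sC.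
  (* This first coordinate minimizes the form in s and leaves the Schur complement; for a = 0 the
     convention 0^-1 = 0 leaves C itself. *)
  have := q (- a^-1 * (b^T *m w) ord0 ord0) w.
  rewrite mulmxBr mulmxBl -scalemxAr -scalemxAl.
  have -> : w^T *m (b *m b^T) *m w = (b^T *m w)^T *m (b^T *m w).
    by rewrite trmx_mul trmxK !mulmxA.
  move: (w^T *m C *m w) (b^T *m w) => M N; rewrite !mxE big_ord1 !mxE.
  have [->|an0 h] := eqVneq a 0; first by rewrite invr0 => h; lra.
  apply: le_trans h _; rewrite le_eqVlt; apply/predU1P; left; field.
  exact: an0.
exists (block_mx (Num.sqrt a)%:M 0 ((Num.sqrt a)^-1 *: b) G').
rewrite [LHS]eZ tr_block_mx mulmx_block !trmx0 !mulmx0 !mul0mx !addr0.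
rewrite linearZ /= tr_scalar_mx -scalar_mxM -expr2 sqr_sqrtr //.
rewrite mul_scalar_mx mul_mx_scalar -scalemxAl -scalemxAr !scalerA -invfM.
rewrite -expr2 sqr_sqrtr // -eG' addrC subrK.
have [a_0|an0] := eqVneq a 0; first by rewrite (b0 a_0) trmx0 !scaler0.
by rewrite divff ?sqrtr_eq0 -?ltNge ?lt_def ?an0 ?a0 // !scale1r.
Qed.

Lemma mxinner_psd_ge0 k (X Y : 'M[R]_k) :
  psdmx X -> psdmx Y -> 0 <= mxinner X Y.
Proof.
by move=> [_ pX] /psdmx_gram[G ->]; rewrite mxinner_gram sumr_ge0.
Qed.

(** Every column of a Gram factor of [Y] contributes a nonnegative term, which is zero only if the
    column vanishes. *)
Lemma mxinner_pd_eq0 k (X Y : 'M[R]_k) :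
  pdmx X -> psdmx Y -> mxinner X Y = 0 -> Y = 0.
Proof.
move=> pX /psdmx_gram[G ->]; rewrite mxinner_gram => /eqP.
rewrite psumr_eq0 => [/allP G0|j _]; last by case: (pdmx_psd pX).
suff -> : G = 0 by rewrite mul0mx.
apply/matrixP=> i j; rewrite [RHS]mxE.
have /= := G0 j; rewrite mem_index_enum => /(_ isT).
have [Gj _|/pX.2/gt_eqF ->//] := eqVneq (col j G) 0.
by move/colP/(_ i): Gj; rewrite !mxE.
Qed.

Lemma psdmx_dual k (X : 'M[R]_k) :
  X \is symmetricmx -> (forall Y, psdmx Y -> 0 <= mxinner X Y) -> psdmx X.
Proof.
by move=> sX pX; split=> // v; rewrite -mxinner_rank1; exact/pX/psdmx_rank1.
Qed.

End PsdMatrices.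

(** * Closed convex cones and separation *)

Section ClosedCones.
Context {R : realType}.

Definition dotrv N (u v : 'rV[R]_N) : R := \sum_k u ord0 k * v ord0 k.

Lemma dotrvC N (u v : 'rV[R]_N) : dotrv u v = dotrv v u.
Proof. by apply: eq_bigr => k _; rewrite mulrC. Qed.

Lemma dotrvDr N (u v w : 'rV[R]_N) : dotrv u (v + w) = dotrv u v + dotrv u w.
Proof. by rewrite -big_split; apply: eq_bigr => k _; rewrite mxE mulrDr. Qed.

Lemma dotrvZr N a (u v : 'rV[R]_N) : dotrv u (a *: v) = a * dotrv u v.
Proof. by rewrite big_distrr; apply: eq_bigr => k _; rewrite mxE mulrCA. Qed.

Lemma dotrvDl N (u v w : 'rV[R]_N) : dotrv (v + w) u = dotrv v u + dotrv w u.
Proof. by rewrite !(dotrvC _ u) dotrvDr. Qed.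

Lemma dotrvZl N a (u v : 'rV[R]_N) : dotrv (a *: v) u = a * dotrv v u.
Proof. by rewrite !(dotrvC _ u) dotrvZr. Qed.

Lemma dotrvBr N (u v w : 'rV[R]_N) : dotrv u (v - w) = dotrv u v - dotrv u w.
Proof. by rewrite -scaleN1r dotrvDr dotrvZr mulN1r. Qed.

Lemma dotrv_ge0 N (u : 'rV[R]_N) : 0 <= dotrv u u.
Proof. by apply: sumr_ge0 => k _; rewrite -expr2 sqr_ge0. Qed.

Lemma dotrv_gt0 N (u : 'rV[R]_N) : u != 0 -> 0 < dotrv u u.
Proof.
move=> u0; rewrite lt_def dotrv_ge0 andbT; apply: contraNneq u0 => /eqP.
rewrite psumr_eq0 => [/allP u0|k _]; last by rewrite -expr2 sqr_ge0.
apply/eqP/rowP => k; rewrite mxE; apply/eqP.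
by have /= := u0 k; rewrite mem_index_enum mulf_eq0 orbb => /(_ isT).
Qed.

Lemma dotrv_line N (u v : 'rV[R]_N) t :
  dotrv (u + t *: v) (u + t *: v) =
  dotrv u u + t * (2 * dotrv u v + t * dotrv v v).
Proof. by rewrite dotrvDl !dotrvDr !dotrvZl !dotrvZr (dotrvC v u); ring. Qed.

Lemma dotrv_continuous N (u : 'rV[R]_N) : continuous (dotrv u).
Proof.
apply: continuous_big => [|k _]; first exact: add_continuous.
by move=> x; apply: continuousM; [exact: cst_continuous|exact: coord_continuous].
Qed.

Lemma dotrv_sqr_continuous N : continuous (fun u : 'rV[R]_N => dotrv u u).
Proof.
apply: continuous_big => [|k _]; first exact: add_continuous.
by move=> x; apply: continuousM; exact: coord_continuous.
Qed.

Lemma mx_continuous (T : topologicalType) m n (f : T -> 'M[R]_(m, n)) :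
  (forall i j, continuous (fun x => f x i j)) -> continuous f.
Proof.
move=> cf x A [P Px PA].
have : \forall y \near x, forall i, forall j, P i j (f y i j).
  by apply: filter_forall => i; apply: filter_forall => j; exact/cf/Px.
by apply: filterS => y Py; apply: PA.
Qed.

Lemma coord_le_norm N (v : 'rV[R]_N) i : `|v ord0 i| <= `|v|.
Proof.
rewrite [leRHS]/Num.norm /= mx_normrE; apply/bigmax_geP; right => /=.
by exists (ord0, i).
Qed.

Lemma norm_le_coord N (v : 'rV[R]_N) r :
  0 <= r -> (forall i, `|v ord0 i| <= r) -> `|v| <= r.
Proof.
move=> r0 vr; rewrite [leLHS]/Num.norm /= mx_normrE.
by apply/bigmax_leP; split=> //= -[i j] _ /=; rewrite ord1.
Qed.

Lemma norm_sqr_le_dotrv N (v : 'rV[R]_N) : `|v| <= Num.sqrt (dotrv v v).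
Proof.
apply: norm_le_coord => [|i]; first exact: sqrtr_ge0.
rewrite -sqrtr_sqr ler_wsqrtr // /dotrv (bigD1 i) //= -expr2 lerDl.
by apply: sumr_ge0 => k _; rewrite -expr2 sqr_ge0.
Qed.

Lemma bounded_rv_compact N (A : set 'rV[R]_N) r :
  closed A -> (forall v, A v -> `|v| <= r) -> compact A.
Proof.
move=> cA bA; apply: bounded_closed_compact cA.
by exists r; split=> [|s rs v /bA vr]; [exact: num_real|exact/ltW/(le_lt_trans vr)].
Qed.

Lemma compact_min (T : topologicalType) (A : set T) (g : T -> R) :
  A !=set0 -> compact A -> continuous g ->
  exists2 c, A c & forall x, A x -> g c <= g x.
Proof.
move=> A0 cA cg.
have [c] := compact_EVT_min A0 cA (continuous_subspaceT cg).
by rewrite inE => Ac gc; exists c => // x Ax; apply: gc; rewrite inE.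
Qed.

Lemma compact_max (T : topologicalType) (A : set T) (g : T -> R) :
  A !=set0 -> compact A -> continuous g ->
  exists2 c, A c & forall x, A x -> g x <= g c.
Proof.
move=> A0 cA cg.
have [c] := compact_EVT_max A0 cA (continuous_subspaceT cg).
by rewrite inE => Ac gc; exists c => // x Ax; apply: gc; rewrite inE.
Qed.

Lemma closed_preimage (T U : topologicalType) (g : T -> U) (D : set U) :
  continuous g -> closed D -> closed (g @^-1` D).
Proof. by move=> cg; apply: preimage_closed => x _; exact: cg. Qed.

Definition cvxset (V : lmodType R) (S : set V) :=
  forall u v t, S u -> S v -> 0 <= t -> t <= 1 -> S ((1 - t) *: u + t *: v).

(* The functional is the inner product with the point of S nearest to 0. *)
Lemma separation0 N (S : set 'rV[R]_N) :
  closed S -> cvxset S -> S !=set0 -> ~ S 0 ->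
  exists w d, 0 < d /\ forall v, S v -> d <= dotrv w v.
Proof.
move=> cS cvS [v0 Sv0] S0; pose Q (u : 'rV[R]_N) := dotrv u u.
have cQ : continuous Q by exact: dotrv_sqr_continuous.
pose S' := S `&` [set v | Q v <= Q v0].
have cS' : compact S'.
  apply: (@bounded_rv_compact _ _ (Num.sqrt (Q v0))).
    by exact: (closedI cS (closed_preimage cQ (@closed_le _ (Q v0)))).
  by move=> v [_ Qv]; apply: le_trans (norm_sqr_le_dotrv v) _; exact: ler_wsqrtr.
have [|w [Sw Qw] wmin] := @compact_min _ S' Q _ cS' cQ.
  by exists v0; split => //=.
have {}wmin v : S v -> Q w <= Q v.
  move=> Sv; have [h|/ltW h] := leP (Q v) (Q v0); first exact: wmin.
  exact: le_trans Qw h.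
exists w, (Q w); split=> [|v Sv].
  by apply: dotrv_gt0; apply: contra_notN S0 => /eqP <-.
rewrite leNgt; apply/negP => wv.
pose a := dotrv w (v - w); pose b := Q (v - w).
have a0 : a < 0 by rewrite /a dotrvBr subr_lt0.
have b0 : 0 <= b by exact: dotrv_ge0.
(* Then 2 a + t b = a (1 + t) < 0, so the step from w towards v shortens w; unlike the minimizer -a
   / b, this t never leaves ]0, 1]. *)
pose t := - a / (b - a).
have ba : 0 < b - a by lra.
have t0 : 0 < t by rewrite divr_gt0 // oppr_gt0.
have t1 : t <= 1 by rewrite ler_pdivrMr // mul1r; lra.
have := wmin _ (cvS _ _ _ Sw Sv (ltW t0) t1).
have -> : (1 - t) *: w + t *: v = w + t *: (v - w).
  by rewrite scalerBl scale1r scalerBr addrA addrAC.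
have -> : Q (w + t *: (v - w)) = Q w + t * (2 * a + t * b).
  exact: dotrv_line.
rewrite lerDl pmulr_rge0 // leNgt => /negP; apply.
have -> : t * b = - a - t * (- a) by rewrite /t; field; rewrite gt_eqF.
by nra.
Qed.

Definition cvxcone N (K : set 'rV[R]_N) :=
  [/\ K 0, forall u v, K u -> K v -> K (u + v)
    & forall a u, 0 <= a -> K u -> K (a *: u)].

(** Apply [separation0] to the translate K - b: a linear functional bounded below on a cone is
    nonnegative on it. *)
Lemma separation_cone N (K : set 'rV[R]_N) b :
  closed K -> cvxcone K -> ~ K b ->
  exists w, (forall v, K v -> 0 <= dotrv w v) /\ dotrv w b < 0.
Proof.
move=> cK [K0 KD KZ] Kb; pose S := [set v | K (v + b)].
have [||||w [d [d0 wd]]] := @separation0 _ S.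
- apply: closed_preimage cK => v.
  by apply: continuousD; [exact: cvg_id|exact: cst_continuous].
- rewrite /S => u v t /= Su Sv t0 t1.
  have -> : (1 - t) *: u + t *: v + b = (1 - t) *: (u + b) + t *: (v + b).
    by rewrite !scalerDr addrACA -scalerDl subrK scale1r.
  by apply: KD; apply: KZ => //; rewrite subr_ge0.
- by exists (- b); rewrite /S /= addNr.
- by rewrite /S /= add0r.
have {}wd v : K v -> d + dotrv w b <= dotrv w v.
  move=> Kv; have := wd (v - b); rewrite /S /= subrK => /(_ Kv).
  by rewrite dotrvBr; lra.
have wb : dotrv w b < 0.
  by have := wd 0 K0; rewrite -(scale0r 0) dotrvZr mul0r; lra.
exists w; split=> // v Kv; rewrite leNgt; apply/negP => wv.
(* Scaled so that the pairing of w with s v falls 1 below the bound [d + dotrv w b]. *)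
pose s := (d + dotrv w b - 1) / dotrv w v.
have db : d + dotrv w b <= 0 by have := wd 0 K0; rewrite -(scale0r 0) dotrvZr mul0r.
have s0 : 0 <= s by rewrite /s ler_ndivlMr // mul0r; lra.
have := wd _ (KZ s v s0 Kv); rewrite dotrvZr /s divfK ?lt_eqF //; lra.
Qed.

(* [|v *m A|] is bounded below by a multiple of [|v|] on [K], so a bounded part
   of the image is the image of a compact part of [K]. *)
Lemma closed_cone_image N M (K : set 'rV[R]_N) (A : 'M[R]_(N, M)) :
  closed K -> (forall a u, 0 <= a -> K u -> K (a *: u)) ->
  (forall u, K u -> u *m A = 0 -> u = 0) ->
  closed [set u *m A | u in K].
Proof.
move=> cK KZ K0.
have cA : continuous (fun u : 'rV[R]_N => u *m A).
  apply: mx_continuous => i j.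
  have -> : (fun x : 'rV[R]_N => (x *m A) i j) = dotrv (col j A)^T.
    by apply/funext => x; rewrite mxE; apply: eq_bigr => k _; rewrite !mxE ord1 mulrC.
  exact: dotrv_continuous.
(* [mu] is the minimum of |u A| over the unit vectors of [K], positive since the kernel meets [K]
   only at 0; the value 1 serves when [K] has no unit vector. *)
have [mu mu0 muK] : exists2 mu : R, 0 < mu & forall u, K u -> mu * `|u| <= `|u *m A|.
  pose S := K `&` [set u | `|u| = 1].
  have cS : compact S.
    apply: (@bounded_rv_compact _ _ 1); last by move=> u [_ ->].
    exact: (closedI cK (closed_preimage (@norm_continuous _ _) (@closed_eq _ 1))).
  have [[u0 Su0]|S0] := pselect (S !=set0); last first.
    exists 1 => // u Ku; have [->|un0] := eqVneq u 0.
      by rewrite normr0 mulr0 normr_ge0.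
    case: S0; exists (`|u|^-1 *: u); split; first by apply: KZ.
    by rewrite /= normrZ normfV normr_id mulVf // normr_eq0.
  have [||c [Kc c1] cmin] := @compact_min _ S (fun u => `|u *m A|) _ cS.
  - by exists u0.
  - by move=> x; apply: continuous_comp; [exact: cA|exact: norm_continuous].
  exists `|c *m A|.
    rewrite normr_gt0; apply: contraPneq c1 => /K0 -/(_ Kc) -> /=.
    by rewrite normr0 => /esym/eqP; rewrite oner_eq0.
  move=> u Ku; have [->|un0] := eqVneq u 0; first by rewrite mul0mx !normr0 mulr0.
  have := cmin (`|u|^-1 *: u); rewrite -scalemxAl normrZ normfV normr_id.
  rewrite ler_pdivlMl ?normr_gt0 // mulrC; apply; split; first exact: KZ.
  by rewrite /= normrZ normfV normr_id mulVf // normr_eq0.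
move=> q qcl; pose r := (`|q| + 1) / mu.
pose Kr := K `&` [set u | `|u| <= r].
have cKr : compact Kr.
  apply: (@bounded_rv_compact _ _ r); last by move=> u [].
  exact: (closedI cK (closed_preimage (@norm_continuous _ _) (@closed_le _ r))).
have : closed [set u *m A | u in Kr].
  apply: compact_closed; first exact: norm_hausdorff.
  by apply: continuous_compact cKr; exact: continuous_subspaceT.
move=> /(_ q); case=> [B Bq|u [Ku _] <-]; last by exists u.
have [|_ [[u Ku <-] [Bu qu]]] := qcl (B `&` ball q 1).
  by apply: filterI => //; exact: nbhsx_ballx.
exists (u *m A); split=> //; exists u => //; split=> //=.
rewrite /r ler_pdivlMr // mulrC; apply: le_trans (muK _ Ku) _.
move: qu; rewrite -ball_normE /= distrC => qu.
rewrite -[u *m A](subrK q); apply: le_trans (ler_normD _ _) _.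
by rewrite addrC lerD2l ltW.
Qed.

End ClosedCones.

(** * Sums of squares and Jensen's inequality *)

Section SumsOfSquares.
Context {R : realType} {n : nat}.
Implicit Types p q : {mpoly R[n]}.

(** [msize] is one more than the degree, so a product keeps only one of the two extra units; hence
    the asymmetric bounds. *)
Lemma msizeM_leD p q a b :
  (msize p <= a)%N -> (msize q <= b.+1)%N -> (msize (p * q) <= a + b)%N.
Proof.
move=> pa qb; have [->|p0] := eqVneq p 0; first by rewrite mul0r mmeasure0.
have [->|q0] := eqVneq q 0; first by rewrite mulr0 mmeasure0.
rewrite msizeM //; apply: leq_trans (_ : (a + b.+1).-1 <= _)%N.
  by rewrite -!subn1 leq_sub2r // leq_add.
by rewrite addnS.
Qed.

Lemma msize_sum_le (I : finType) (P : pred I) (q : I -> {mpoly R[n]}) k :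
  (forall i, P i -> msize (q i) <= k)%N -> (msize (\sum_(i | P i) q i) <= k)%N.
Proof.
move=> qk; elim/big_ind: _ => //; first by rewrite mmeasure0.
by move=> p1 p2 h1 h2; apply: leq_trans (mmeasureD_le _ _ _) _; rewrite geq_max h1.
Qed.

Lemma msize_mderiv p k : (msize p^`M(k) <= (msize p).-1)%N.
Proof.
rewrite [X in (X <= _)%N]mmeasureE; apply/bigmax_leqP_seq => m + _.
rewrite mcoeff_msupp mcoeff_mderiv => pm.
have : (m + U_(k))%MM \in msupp p.
  by rewrite mcoeff_msupp; apply: contraNneq pm => ->; rewrite mul0rn.
by move/msize_mdeg_lt; rewrite mdegD mdeg1 addn1; case: (msize p).
Qed.

(* Leading terms of squares do not cancel. *)
Lemma msize_sum_sqr (r : nat) (q : 'I_r -> {mpoly R[n]}) (N : nat) (s : 'I_r) :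
  (msize (\sum_j q j * q j) <= N)%N -> (2 * msize (q s) <= N.+1)%N.
Proof.
move=> qN; have [->|qs0] := eqVneq (q s) 0; first by rewrite mmeasure0.
case: (Order.TotalTheory.arg_maxP (fun j => mlead (q j)) (i0 := s)
         (P := fun j => q j != 0) qs0) => t qt0 tmax.
pose mu := mlead (q t).
have lemu j : (mlead (q j) <= mu)%O.
  have [->|/tmax//] := eqVneq (q j) 0; by rewrite mlead0; exact: le0m.
(* No leading monomial exceeds [mu], so the coefficient of each square at mu + mu is the square of
   its coefficient at mu, and the one from [t] is nonzero. *)
have : (mu + mu)%MM \in msupp (\sum_j q j * q j).
  rewrite mcoeff_msupp raddf_sum /= gt_eqF //.
  rewrite (eq_bigr (fun j => (q j)@_mu ^+ 2)); last first.
    by move=> j _; rewrite mleadcMW // expr2.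
  rewrite (bigD1 t) //= ltr_wpDr //; first by apply: sumr_ge0 => j _; exact: sqr_ge0.
  by rewrite lt_def sqr_ge0 andbT expf_neq0 // mleadc_eq0.
move=> /msize_mdeg_lt /leq_trans -/(_ _ qN); rewrite mdegD => muN.
rewrite -mlead_deg //; have := lemc_mdeg (lemu s).
move: (mdeg _) (mdeg mu) muN => a b muN ab.
rewrite mulnS mul2n -addnn addnC addn2 !ltnS.
by apply: leq_ltn_trans muN; rewrite leq_add.
Qed.

Lemma msize_comp_affine p (g : n.-tuple {mpoly R[n]}) :
  (forall i, msize (tnth g i) <= 2)%N -> (msize (p \mPo g) <= msize p)%N.
Proof.
move=> g2; have gX k i : (msize (tnth g i ^+ k) <= k.+1)%N.
  elim: k => [|k IH]; first by rewrite expr0 msize1.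
  by rewrite exprS mulrC -addn1; exact: msizeM_leD.
have gP m (r : seq 'I_n) :
    (msize (\prod_(i <- r) tnth g i ^+ m i) <= (\sum_(i <- r) m i).+1)%N.
  elim: r => [|i r IH]; first by rewrite !big_nil msize1.
  by rewrite !big_cons -addSn; exact: msizeM_leD.
rewrite comp_mpolyEX big_seq; elim/big_ind: _ => [|p1 p2 h1 h2|m pm].
- by rewrite mmeasure0.
- by apply: leq_trans (mmeasureD_le _ _ _) _; rewrite geq_max h1.
- apply: leq_trans (msizeZ_le _ _) _; rewrite comp_mpolyX.
  apply: leq_trans (gP _ _) _; apply: leq_trans (msize_mdeg_lt pm).
  by rewrite mdegE.
Qed.

(** P' is nondecreasing, so P - P'(0) X is nondecreasing on [0, 1]. *)
Lemma poly_convex_tangent (P : {poly R}) :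
  (forall t, 0 <= P^`()^`().[t]) -> P.[0] + P^`().[0] <= P.[1].
Proof.
move=> P2; have in0 : (0 : R) \in `[0, 1] by rewrite in_itv /= lexx ler01.
have in1 : (1 : R) \in `[0, 1] by rewrite in_itv /= lexx ler01.
pose Q := P - P^`().[0] *: 'X.
have : Q.[0] <= Q.[1].
  apply: (@ler_hornerW R 0 1 Q) => // x x01.
  rewrite /Q derivB derivZ derivX !hornerE subr_ge0.
  have x01' : x \in `[0, 1] by apply: subset_itv_oo_cc.
  by apply: (@ler_hornerW R 0 1 P^`()) => //; case/andP: x01' => //.
by rewrite /Q !hornerE; lra.
Qed.

End SumsOfSquares.

Section ChainRule.
Context {R : realType} {n : nat}.
Local Notation A := {mpoly R[n]}.
Variables (Phi : {rmorphism A -> {poly A}}) (g : 'I_n -> A).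
Hypothesis PhiC : forall a, Phi a%:MP = (a%:MP)%:P.
Hypothesis PhiX : forall k, (Phi 'X_k)^`() = (g k)%:P.

(** The chain rule for substituting into x_k a polynomial in t of constant velocity g_k. Stated for
    a ring morphism, it passes from constants and variables to all polynomials through sums and
    products. *)
Lemma deriv_rmorph p : (Phi p)^`() = \sum_k Phi p^`M(k) * (g k)%:P.
Proof.
pose D q := (Phi q)^`() = \sum_k Phi q^`M(k) * (g k)%:P.
have DC a : D a%:MP.
  rewrite /D PhiC derivC big1 // => k _.
  by rewrite mderivC rmorph0 mul0r.
have DD q1 q2 : D q1 -> D q2 -> D (q1 + q2).
  move=> D1 D2; rewrite /D rmorphD derivD D1 D2 -big_split.
  by apply: eq_bigr => k _; rewrite mderivD rmorphD mulrDl.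
have DM q1 q2 : D q1 -> D q2 -> D (q1 * q2).
  move=> D1 D2; rewrite /D rmorphM derivM D1 D2.
  rewrite mulr_suml mulr_sumr -big_split; apply: eq_bigr => k _.
  by rewrite mderivM rmorphD !rmorphM mulrDl mulrAC -!mulrA.
have DX k : D 'X_k.
  rewrite /D PhiX (bigD1 k) //= big1 => [|i ik].
    rewrite addr0 mderivX mnm1E eqxx scale1r -[X in (X - _)%MM]add0m addmK.
    by rewrite mpolyX0 rmorph1 mul1r.
  by rewrite mderivX mnm1E eq_sym (negbTE ik) scale0r rmorph0 mul0r.
have DXm m : D 'X_[m].
  rewrite mpolyXE_id; elim/big_ind: _ => [|//|i _]; first exact: (DC 1).
  elim: (m i) => [|k IH]; first exact: (DC 1).
  by rewrite exprS; apply: DM.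
apply: (mpolyind (P := D)) => [|a m q _ _ Dq]; first exact: (DC 0).
by apply: DD => //; rewrite -mul_mpolyC; apply: DM.
Qed.

End ChainRule.

Section Jensen.
Context {R : realType} {n : nat}.
Variable c : 'I_n -> R.
Local Notation A := {mpoly R[n]}.

(* [ray_morph p] is p(c + t (x - c)), as a polynomial in t over R[x]. *)
Definition ray (k : 'I_n) : {poly A} :=
  ((c k)%:MP)%:P + ('X_k - (c k)%:MP)%:P * 'X.

Definition ray_morph : A -> {poly A} := mmap (polyC \o @mpolyC n R) ray.

HB.instance Definition _ := GRing.RMorphism.on ray_morph.

(** The ray at a real parameter t: affine polynomials in x, so that composing with them does not
    raise the degree. *)
Definition ray_tuple (t : R) : n.-tuple A :=
  [tuple (c k)%:MP + t *: ('X_k - (c k)%:MP) | k < n].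

Lemma ray_morph_horner p t : (ray_morph p).[t%:MP] = p \mPo ray_tuple t.
Proof.
rewrite comp_mpolyEX /ray_morph /mmap horner_sum; apply: eq_bigr => m _.
rewrite hornerM hornerC mul_mpolyC comp_mpolyX /mmap1 horner_prod.
congr (_ *: _); apply: eq_bigr => i _.
by rewrite tnth_mktuple horner_exp /ray !hornerE mulrC mul_mpolyC.
Qed.

Lemma ray_morph1 p : (ray_morph p).[1] = p.
Proof.
rewrite -[1]/(1%:MP) ray_morph_horner -[RHS]comp_mpoly_id; congr (_ \mPo _).
by apply: eq_from_tnth => i; rewrite !tnth_mktuple scale1r addrC subrK.
Qed.

Lemma ray_morph0 p : (ray_morph p).[0] = (p.@[c])%:MP.
Proof.
rewrite -[0 in LHS](mpolyC0 n R) ray_morph_horner comp_mpolyEX mevalE.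
rewrite [RHS]rmorph_sum; apply: eq_bigr => m _ /=.
rewrite mpolyCM mul_mpolyC comp_mpolyX rmorph_prod; congr (_ *: _).
by apply: eq_bigr => i _; rewrite tnth_mktuple scale0r addr0 rmorphXn.
Qed.

Lemma ray_morphC a : ray_morph a%:MP = (a%:MP)%:P.
Proof. by rewrite /ray_morph mmapC. Qed.

Lemma ray_morphX k : ray_morph 'X_k = ray k.
Proof. by rewrite /ray_morph mmapX mmap1U. Qed.

Lemma deriv_ray_morph p :
  (ray_morph p)^`() = \sum_k ray_morph p^`M(k) * ('X_k - (c k)%:MP)%:P.
Proof.
apply: deriv_rmorph => [a|k]; first exact: ray_morphC.
rewrite [X in X^`()](ray_morphX k) /ray derivD derivM !derivC derivX.
by rewrite mul0r mulr1 !add0r.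
Qed.

Variables (L : {linear A -> R | *%R}) (d : nat).
Hypothesis L_sos : forall q, (msize q <= d.+1)%N -> 0 <= L (q * q).

Lemma horner_map_linear (P : {poly A}) t : (map_poly L P).[t] = L P.[t%:MP].
Proof.
rewrite (@horner_coef_wide _ (size P)) ?size_poly // horner_coef linear_sum.
apply: eq_bigr => i _; rewrite coef_map_id0 ?linear0 // mulrC.
by rewrite -(rmorphXn (@mpolyC n R)) [P`_i * _]mulrC mul_mpolyC linearZ.
Qed.

Lemma deriv_map_linear (P : {poly A}) : (map_poly L P)^`() = map_poly L P^`().
Proof.
apply/polyP => i; rewrite coef_deriv !coef_map_id0 ?linear0 //.
by rewrite coef_deriv linearMn.
Qed.

(** P(t) = L(h(c + t (x - c))), with L acting on the coefficients in x, is convex: by the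
    factorization of the Hessian, P''(t) is L of a sum of squares. The claim is that P lies above
    its tangent at 0 when t = 1. The centre c is free: the barycentre of L gives Jensen's
    inequality, and a point evaluation L gives the gradient inequality. *)
Lemma sos_convex_jensen h : (msize h <= (2 * d).+1)%N -> sos_convex h ->
  h.@[c] * L 1 + \sum_k (h^`M(k)).@[c] * L ('X_k - (c k)%:MP) <= L h.
Proof.
move=> hd [r [F hF]]; pose P := map_poly L (ray_morph h).
have P0 : P.[0] = h.@[c] * L 1.
  by rewrite horner_map_linear ray_morph0 -[_%:MP]mulr1 mul_mpolyC linearZ.
have P1 : P.[1] = L h by rewrite horner_map_linear ray_morph1.
have P'0 : P^`().[0] = \sum_k (h^`M(k)).@[c] * L ('X_k - (c k)%:MP).
  rewrite deriv_map_linear horner_map_linear deriv_ray_morph horner_sum.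
  rewrite linear_sum; apply: eq_bigr => k _.
  by rewrite hornerM hornerC ray_morph0 mul_mpolyC linearZ.
rewrite -P0 -P'0 -P1; apply: poly_convex_tangent => t.
(* The diagonal entry of the Hessian is the sum of the squares of row k of F and has degree at most
   2d - 2, so the entries of F have degree at most d - 1, and vanish when d = 0. *)
have Fd k s : (msize (F k s) <= d)%N.
  have hkk : \sum_s F k s * F k s = h^`M(k)^`M(k).
    have /matrixP/(_ k k) := hF; rewrite !mxE => ->.
    by apply: eq_bigr => j _; rewrite mxE.
  have /= := @msize_sum_sqr R n r (fun s => F k s) (2 * d).-1 s.
  rewrite hkk => /(_ _)/leq_trans le2F.
  rewrite -ltnS -(ltn_pmul2l (isT : 0 < 2)%N) mulnS ltnS; apply: le2F.
    apply: leq_trans (msize_mderiv _ _) _; rewrite -!subn1 leq_sub2r //.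
    by apply: leq_trans (msize_mderiv _ _) _; rewrite -subn1 leq_subLR add1n.
  by rewrite ltnS leq_pred.
(* q_s is entry s of F^T (x - c), with F taken at the point c + t (x - c); its degree is at most
   d. *)
pose q s := \sum_k (F k s \mPo ray_tuple t) * ('X_k - (c k)%:MP).
have -> : P^`()^`().[t] = L (\sum_s q s * q s).
  rewrite !deriv_map_linear horner_map_linear deriv_ray_morph linear_sum /=.
  congr (L _); rewrite horner_sum.
  rewrite (eq_bigr (fun k => \sum_l \sum_s
      ((F k s \mPo ray_tuple t) * ('X_k - (c k)%:MP)) *
      ((F l s \mPo ray_tuple t) * ('X_l - (c l)%:MP)))).
    under eq_bigr do rewrite exchange_big /=.
    by rewrite exchange_big; apply: eq_bigr => s _; rewrite /q big_distrlr.
  move=> k _; rewrite derivM derivC mulr0 addr0 deriv_ray_morph.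
  rewrite hornerM hornerC horner_sum mulr_suml; apply: eq_bigr => l _.
  rewrite hornerM hornerC ray_morph_horner.
  have /matrixP/(_ k l) := hF; rewrite !mxE => ->.
  rewrite rmorph_sum !mulr_suml; apply: eq_bigr => s _.
  by rewrite mxE rmorphM /=; ring.
rewrite linear_sum; apply: sumr_ge0 => s _; apply: L_sos.
have Xc k : (msize ('X_k - (c k)%:MP) <= 2)%N.
  apply: leq_trans (mmeasureD_le _ _ _) _; rewrite geq_max mmeasureN.
  by rewrite msizeX mdeg1 msizeC; case: eqP.
apply: msize_sum_le => k _; rewrite -addn1; apply: msizeM_leD => //.
apply: leq_trans (Fd k s); apply: msize_comp_affine => i.
rewrite tnth_mktuple; apply: leq_trans (mmeasureD_le _ _ _) _.
rewrite geq_max (leq_trans (msizeZ_le _ _) (Xc _)) msizeC.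
by case: eqP.
Qed.

End Jensen.

(** * Semidefinite Farkas lemma and Gram matrices *)

Section SemidefiniteFarkas.
Context {R : realType}.

Lemma dotrv_mxvec k (X Y : 'M[R]_k) : dotrv (mxvec X) (mxvec Y) = mxinner X^T Y.
Proof.
transitivity (\sum_i \sum_j X i j * Y i j).
  rewrite /dotrv (reindex _ (curry_mxvec_bij _ _)) /= pair_bigA /=.
  by apply: eq_bigr => -[i j] _ /=; rewrite !mxvecE.
rewrite exchange_big; apply: eq_bigr => j _; rewrite mxE; apply: eq_bigr => i _.
by rewrite mxE.
Qed.

Lemma dotrv_mxvec_delta k (X : 'M[R]_k) i j :
  dotrv (mxvec (delta_mx i j - delta_mx j i)) (mxvec X) = X i j - X j i.
Proof.
have delE (i' j' : 'I_k) : mxinner (delta_mx i' j') X = X j' i'.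
  rewrite /mxinner -(mul_delta_mx (ord0 : 'I_1)) -mulmxA mxtrace_mulC.
  by rewrite -rowE -colE /mxtrace big_ord1 !mxE.
rewrite dotrv_mxvec linearB /= !trmx_delta mxinnerDl -scaleN1r mxinnerZl.
by rewrite !delE mulN1r.
Qed.

Lemma closed_psdmx k : closed [set u : 'rV[R]_(k * k) | psdmx (vec_mx u)].
Proof.
pose S1 (X : 'M[R]_k) := [set u | dotrv (mxvec X) u = 0].
pose S2 (v : 'cV[R]_k) := [set u | 0 <= dotrv (mxvec (v *m v^T)) u].
have -> : [set u : 'rV[R]_(k * k) | psdmx (vec_mx u)] =
    (\bigcap_(ij in [set: 'I_k * 'I_k])
        S1 (delta_mx ij.1 ij.2 - delta_mx ij.2 ij.1)) `&` \bigcap_v S2 v.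
  apply/seteqP; split=> u /=.
    move=> [/symmetricmxP sX pX]; split=> [[i j] _|v _].
      rewrite /S1 /= -[u]vec_mxK dotrv_mxvec_delta.
      have -> : vec_mx u i j = vec_mx u j i by rewrite -[in LHS]sX mxE.
      exact: subrr.
    by rewrite /S2 /= -[u]vec_mxK dotrv_mxvec trmx_mul trmxK mxinnerC mxinner_rank1.
  move=> [s p]; split=> [|v].
    apply/symmetricmxP/matrixP=> i j; rewrite mxE; apply/eqP.
    have := s (j, i) I; rewrite /S1 /= -[u]vec_mxK dotrv_mxvec_delta vec_mxK.
    by rewrite -subr_eq0 => ->.
  rewrite -mxinner_rank1 mxinnerC; have := p v I.
  by rewrite /S2 /= -[u]vec_mxK dotrv_mxvec trmx_mul trmxK vec_mxK.
apply: closedI; apply: closed_bigI => x _.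
  exact: (closed_preimage (@dotrv_continuous _ _ _) (@closed_eq _ 0)).
exact: (closed_preimage (@dotrv_continuous _ _ _) (@closed_ge _ 0)).
Qed.

(** The second hypothesis makes the image of the psd cone under Z |-> (<G a, Z>)_a closed. If b were
    outside, a separating w would give, by self-duality of the psd cone, a psd combination of the
    [G a] with negative value at b, against the third. *)
Lemma sdp_farkas (I : finType) k (G : I -> 'M[R]_k) (b : I -> R) :
  (forall a, G a \is symmetricmx) ->
  (forall Z, psdmx Z -> (forall a, mxinner (G a) Z = 0) -> Z = 0) ->
  (forall w : I -> R, psdmx (\sum_a w a *: G a) -> 0 <= \sum_a w a * b a) ->
  exists2 Z, psdmx Z & forall a, mxinner (G a) Z = b a.
Proof.
move=> sG G0 wb.
have sGT a : (G a)^T = G a by exact/symmetricmxP.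
pose A : 'M[R]_(k * k, #|I|) := \matrix_(i, a) mxvec (G (enum_val a)) ord0 i.
have AE (Z : 'M[R]_k) a : (mxvec Z *m A) ord0 a = mxinner (G (enum_val a)) Z.
  rewrite -(sGT (enum_val a)) -dotrv_mxvec dotrvC mxE.
  by apply: eq_bigr => i _; rewrite [A _ _]mxE.
pose K := [set u : 'rV[R]_(k * k) | psdmx (vec_mx u)].
have KZ a u : 0 <= a -> K u -> K (a *: u).
  by move=> a0; rewrite /K /= linearZ; exact: psdmxZ.
have cT : closed [set u *m A | u in K].
  apply: closed_cone_image => //; first exact: closed_psdmx.
  move=> u Ku uA; rewrite -[u]vec_mxK (G0 (vec_mx u)) ?linear0 // => a.
  by rewrite -(enum_rankK a) -AE vec_mxK uA mxE.
have coneT : cvxcone [set u *m A | u in K].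
  split=> [|_ _ [u Ku <-] [v Kv <-]|a _ a0 [u Ku <-]].
  - by exists 0; rewrite ?mul0mx // /K /= linear0; exact: psdmx0.
  - by exists (u + v); rewrite ?mulmxDl // /K /= linearD; exact: psdmxD.
  - by exists (a *: u); rewrite -?scalemxAl //; exact: KZ.
pose bv : 'rV[R]_#|I| := \row_a b (enum_val a).
have [[u Ku ub]|nTb] := pselect ([set u *m A | u in K] bv).
  exists (vec_mx u) => // a.
  by rewrite -(enum_rankK a) -AE vec_mxK ub mxE.
have [w [wT wbv]] := separation_cone cT coneT nTb.
have sumE (F : I -> R) : \sum_a w ord0 (enum_rank a) * F a =
    \sum_i w ord0 i * F (enum_val i).
  rewrite (reindex _ (onW_bij _ (enum_val_bij I))) /=.
  by apply: eq_bigr => i _; rewrite enum_valK.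
suff /wb : psdmx (\sum_a w ord0 (enum_rank a) *: G a).
  rewrite sumE leNgt => /negP; case; move: wbv.
  by congr (_ < _); apply: eq_bigr => i _; rewrite mxE.
apply: psdmx_dual.
  apply/symmetricmxP; rewrite linear_sum; apply: eq_bigr => a _ /=.
  by rewrite linearZ /= sGT.
move=> Z pZ; rewrite mxinner_suml; under eq_bigr do rewrite mxinnerZl.
rewrite sumE; have := wT (mxvec Z *m A).
rewrite /dotrv; under eq_bigr do rewrite AE.
by apply; exists (mxvec Z) => //; rewrite /K /= mxvecK.
Qed.

End SemidefiniteFarkas.

(** * Truncated moment functionals and the Gram matrices of SOS-convex polynomials *)

Section Moments.
Context {R : realType} {n : nat}.

Lemma Lfun_is_scalar k (y : {ffun expo n k -> R}) :
  scalar (Lfun y : {mpoly R[n]} -> R).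
Proof.
move=> a p q; rewrite /Lfun mulr_sumr -big_split; apply: eq_bigr => m _ /=.
by rewrite mcoeffD mcoeffZ mulrDl mulrA.
Qed.

HB.instance Definition _ k (y : {ffun expo n k -> R}) :=
  GRing.isLinear.Build R {mpoly R[n]} R *%R (Lfun y) (Lfun_is_scalar y).

Lemma Lfun1 k (y : {ffun expo n k -> R}) : Lfun y 1 = y bm0.
Proof.
rewrite /Lfun (bigD1 bm0) //= big1 ?addr0 => [|a a0].
  by rewrite mcoeff1 eqxx mul1r.
rewrite mcoeff1 (_ : _ == _ = false) ?mul0r //; apply: negbTE.
  by apply: contraNneq a0 => a0; apply/eqP/val_inj.
Qed.

Definition point_moments k (x : 'I_n -> R) : {ffun expo n k -> R} :=
  [ffun a : expo n k => ('X_[R, a]).@[x]].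

Lemma Lfun_point k (x : 'I_n -> R) p :
  (msize p <= k.+1)%N -> Lfun (point_moments k x) p = p.@[x].
Proof.
move=> pk; rewrite [in RHS](mpolywE pk) raddf_sum /=.
by apply: eq_bigr => a _; rewrite ffunE mevalZ.
Qed.

Variable d : nat.
Local Notation N := #|{: expo n d}|.
Local Notation mono i := ('X_[R, (enum_val i : expo n d)]).

Definition vec_poly (v : 'cV[R]_N) : {mpoly R[n]} :=
  \sum_i v i ord0 *: mono i.

Definition poly_vec (q : {mpoly R[n]}) : 'cV[R]_N :=
  \col_i q@_(enum_val i : expo n d).

Lemma poly_vecK q : (msize q <= d.+1)%N -> vec_poly (poly_vec q) = q.
Proof.
move=> qd; rewrite [RHS](mpolywE qd) (reindex _ (onW_bij _ (enum_val_bij _))) /=.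
by apply: eq_bigr => i _; rewrite mxE.
Qed.

Lemma msize_mono (i : 'I_N) : (msize (mono i) <= d.+1)%N.
Proof. by rewrite msizeX; exact: bmdeg. Qed.

Lemma msize_vec_poly v : (msize (vec_poly v) <= d.+1)%N.
Proof.
apply: msize_sum_le => i _.
exact: leq_trans (msizeZ_le _ _) (msize_mono i).
Qed.

Lemma vec_polyK v : poly_vec (vec_poly v) = v.
Proof.
apply/colP => i; rewrite mxE /vec_poly raddf_sum (bigD1 i) //= big1 => [|j ji].
  by rewrite mcoeffZ mcoeffX eqxx mulr1 addr0.
rewrite mcoeffZ mcoeffX (_ : _ == _ = false) ?mulr0 //.
by apply: contraNF ji => /eqP/val_inj/enum_val_inj ->.
Qed.

Lemma BmxE (a : expo n (2 * d)) i j : Bmx a i j = (mono i * mono j)@_a :> R.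
Proof. by rewrite !mxE big_ord1 !mxE. Qed.

Lemma Bmx_sym (a : expo n (2 * d)) : (Bmx a : 'M[R]_N) \is symmetricmx.
Proof. by apply/symmetricmxP/matrixP=> i j; rewrite mxE !BmxE mulrC. Qed.

Lemma Bmx_quadratic (a : expo n (2 * d)) v :
  (v^T *m Bmx a *m v) ord0 ord0 = (vec_poly v * vec_poly v)@_a.
Proof.
rewrite mxE /vec_poly mulr_sumr raddf_sum; apply: eq_bigr => j _ /=.
rewrite mxE -scalerAr mcoeffZ mulrC; congr (_ * _).
rewrite mulr_suml raddf_sum; apply: eq_bigr => i _ /=.
by rewrite -scalerAl mcoeffZ mxE BmxE.
Qed.

Lemma moment_mxE (y : {ffun expo n (2 * d) -> R}) i j :
  (\sum_a y a *: Bmx a) i j = Lfun y (mono i * mono j).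
Proof.
by rewrite summxE; apply: eq_bigr => a _; rewrite mxE BmxE mulrC.
Qed.

Lemma Lfun_sqr (y : {ffun expo n (2 * d) -> R}) q : (msize q <= d.+1)%N ->
  Lfun y (q * q) =
  ((poly_vec q)^T *m (\sum_a y a *: Bmx a) *m poly_vec q) ord0 ord0.
Proof.
move=> qd; rewrite -{1 2}(poly_vecK qd) mulmx_sumr mulmx_suml summxE.
apply: eq_bigr => a _.
by rewrite -scalemxAr -scalemxAl mxE Bmx_quadratic mulrC.
Qed.

Definition psd_moments (y : {ffun expo n (2 * d) -> R}) :=
  psdmx (\sum_a y a *: Bmx a).

Lemma Lfun_sos y q : psd_moments y -> (msize q <= d.+1)%N -> 0 <= Lfun y (q * q).
Proof. by move=> [_ py] /Lfun_sqr->; exact: py. Qed.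

Lemma psd_moments_sym (y : {ffun expo n (2 * d) -> R}) :
  (\sum_a y a *: Bmx a : 'M[R]_N) \is symmetricmx.
Proof.
by apply/symmetricmxP/matrixP=> i j; rewrite mxE !moment_mxE mulrC.
Qed.

Lemma psd_momentsP y :
  (forall q, (msize q <= d.+1)%N -> 0 <= Lfun y (q * q)) -> psd_moments y.
Proof.
move=> yq; split=> [|v]; first exact: psd_moments_sym.
by have := yq _ (msize_vec_poly v); rewrite Lfun_sqr ?msize_vec_poly // vec_polyK.
Qed.

Lemma msize_sqr (q : {mpoly R[n]}) :
  (msize q <= d.+1)%N -> (msize (q * q) <= (2 * d).+1)%N.
Proof. by move=> qd; rewrite mul2n -addnn -addSn; exact: msizeM_leD. Qed.

Lemma psd_point_moments x : psd_moments (point_moments (2 * d) x).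
Proof.
apply: psd_momentsP => q qd; rewrite Lfun_point ?msize_sqr // rmorphM.
by rewrite -expr2 sqr_ge0.
Qed.

Lemma psd_momentsD y z : psd_moments y -> psd_moments z -> psd_moments (y + z).
Proof.
move=> py pz; rewrite /psd_moments.
under eq_bigr do rewrite ffunE scalerDl; rewrite big_split; exact: psdmxD.
Qed.

Lemma psd_momentsZ a y : 0 <= a -> psd_moments y -> psd_moments (a *: y).
Proof.
move=> a0 py; rewrite /psd_moments.
under eq_bigr do rewrite ffunE -scalerA; rewrite -scaler_sumr; exact: psdmxZ.
Qed.

(** For c the barycentre, L(x_k - c_k) = 0, so the first-order term of [sos_convex_jensen]
    vanishes. *)
Lemma Lfun_jensen y h : psd_moments y -> 0 < y bm0 ->
  (msize h <= (2 * d).+1)%N -> sos_convex h ->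
  y bm0 * h.@[fun k => (y bm0)^-1 * Lfun y 'X_k] <= Lfun y h.
Proof.
move=> py y0 hd hc.
have := sos_convex_jensen (fun k => (y bm0)^-1 * Lfun y 'X_k)
          (fun q => Lfun_sos py) hd hc.
rewrite big1 => [|k _]; first by rewrite addr0 /= Lfun1 mulrC.
rewrite linearB /= -[_%:MP]mulr1 mul_mpolyC linearZ /= Lfun1 mulrAC mulVf ?gt_eqF //.
by rewrite mul1r subrr mulr0.
Qed.

(** The functional is evaluation at x, nonnegative on all squares, so [msize h] can serve as the
    degree bound. *)
Lemma sos_convex_tangent h (c x : 'I_n -> R) : sos_convex h ->
  h.@[c] + \sum_k (h^`M(k)).@[c] * (x k - c k) <= h.@[x].
Proof.
move=> hc; have := @sos_convex_jensen R n c (meval x) (msize h) _ h _ hc.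
rewrite /= meval1 mulr1 => /(_ _ _).
under eq_bigr do rewrite mevalB mevalXU mevalC.
apply=> [q _|]; first by rewrite mevalM -expr2 sqr_ge0.
by rewrite mul2n -addnn -addSn leqW // leq_addr.
Qed.

(** Jensen's inequality bounds L(h) below by y_0 times a value of h, but requires y_0 > 0. Adding
    eps times the moments of the origin makes this component positive, and eps is removed
    afterwards. *)
Lemma sos_convex_Lfun_ge0 y h : psd_moments y ->
  (msize h <= (2 * d).+1)%N -> sos_convex h -> (forall x, 0 <= h.@[x]) ->
  0 <= Lfun y h.
Proof.
move=> py hd hc h0.
have y0 : 0 <= y bm0.
  by rewrite -Lfun1 -[1]mulr1; apply: Lfun_sos; rewrite // msize1.
pose e (k : 'I_n) : R := 0.
suff he eps : 0 < eps -> 0 <= Lfun y h + eps * h.@[e].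
  rewrite leNgt; apply/negP => yh.
  have h1 : 0 < h.@[e] + 1 by apply: ltr_wpDl; rewrite ?h0.
  (* With this eps the perturbed value is L(h) times 1 - h(0) / (h(0) + 1), which stays negative. *)
  have eps0 : 0 < - Lfun y h / (h.@[e] + 1) by rewrite divr_gt0 // oppr_gt0.
  have := he _ eps0; rewrite -mulrA [_^-1 * _]mulrC.
  have : h.@[e] / (h.@[e] + 1) < 1 by rewrite ltr_pdivrMr // mul1r ltrDl.
  by nra.
move=> eps0; pose z := y + eps *: point_moments (2 * d) e.
have pz : psd_moments z.
  by apply/psd_momentsD/psd_momentsZ/psd_point_moments/ltW.
have zE q : (msize q <= (2 * d).+1)%N -> Lfun z q = Lfun y q + eps * q.@[e].
  move=> qd; rewrite -(Lfun_point e qd) /Lfun mulr_sumr -big_split.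
  by apply: eq_bigr => a _; rewrite !ffunE mulrDr; congr (_ + _); exact: mulrCA.
have z0 : 0 < z bm0.
  by rewrite -Lfun1 zE ?msize1 // Lfun1 meval1 mulr1; exact: ltr_wpDl.
rewrite -zE //; apply: le_trans (Lfun_jensen pz z0 hd hc).
by rewrite mulr_ge0 // ltW.
Qed.

(** For Z = G G^T the numbers <B_alpha, Z> are the coefficients of the sum of squares of the
    polynomials given by the columns of G, and squares do not cancel. This is the closedness
    hypothesis of [sdp_farkas] for the matrices B_alpha. *)
Lemma Bmx_psd_eq0 (Z : 'M[R]_N) : psdmx Z ->
  (forall a : expo n (2 * d), mxinner (Bmx a) Z = 0) -> Z = 0.
Proof.
move=> /psdmx_gram[G ->] G0; suff -> : G = 0 by rewrite mul0mx.
have sq0 : \sum_s vec_poly (col s G) * vec_poly (col s G) = 0.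
  have sd : (msize (\sum_s vec_poly (col s G) * vec_poly (col s G)) <= (2 * d).+1)%N.
    by apply: msize_sum_le => s _; rewrite msize_sqr // msize_vec_poly.
  rewrite (mpolywE sd) big1 // => a _.
  have := G0 a; rewrite mxinner_gram; under eq_bigr do rewrite Bmx_quadratic.
  by rewrite -raddf_sum => ->; rewrite scale0r.
apply/matrixP=> i s; rewrite mxE.
have := @msize_sum_sqr R n _ (fun s => vec_poly (col s G)) 0 s.
rewrite sq0 mmeasure0 => /(_ isT) m1.
have : vec_poly (col s G) = 0.
  apply/eqP; rewrite -msize_poly_eq0 -leqn0 -ltnS.
  by rewrite -(ltn_pmul2l (isT : 0 < 2)%N).
by move/(congr1 poly_vec); rewrite vec_polyK => /colP/(_ i); rewrite !mxE mcoeff0.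
Qed.

(* The cone of Gram-representable polynomials is closed, hence it suffices to
   test [h] against the functionals that are nonnegative on squares. *)
Lemma sos_convex_gram h :
  (msize h <= (2 * d).+1)%N -> sos_convex h -> (forall x, 0 <= h.@[x]) ->
  exists2 X : 'M[R]_N, psdmx X &
    forall a : expo n (2 * d), mxinner (Bmx a) X = h@_a.
Proof.
move=> hd hc h0; apply: sdp_farkas => [a||w pw].
- exact: Bmx_sym.
- exact: Bmx_psd_eq0.
have := @sos_convex_Lfun_ge0 [ffun a => w a] h _ hd hc h0.
rewrite /psd_moments; under eq_bigr do rewrite ffunE.
move=> /(_ pw) /le_trans; apply; rewrite le_eqVlt; apply/predU1P; left.
by apply: eq_bigr => a _; rewrite ffunE mulrC.
Qed.

End Moments.

(** * A minimax alternative for closed cones *)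

Section ConeAlternative.
Context {R : realType}.

(* Pairing with [slice x] turns (u, r) into <u, x> - r. *)
Definition slice n (x : 'rV[R]_n) : 'rV[R]_(n + 1) := row_mx x (const_mx (-1)).

Lemma dotrv_row_mx n p (a b : 'rV[R]_n) (c d : 'rV[R]_p) :
  dotrv (row_mx a c) (row_mx b d) = dotrv a b + dotrv c d.
Proof.
rewrite /dotrv big_split_ord /=; congr (_ + _); apply: eq_bigr => k _.
  by rewrite !row_mxEl.
by rewrite !row_mxEr.
Qed.

Lemma dotrv_slice n (x u : 'rV[R]_n) (r : 'rV[R]_1) :
  dotrv (slice x) (row_mx u r) = dotrv x u - r ord0 ord0.
Proof.
by rewrite dotrv_row_mx; congr (_ + _); rewrite /dotrv big_ord1 mxE mulN1r.
Qed.

Lemma dotrv0r n (u : 'rV[R]_n) : dotrv u 0 = 0.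
Proof. by rewrite -(scale0r 0) dotrvZr mul0r. Qed.

Lemma dotrv_delta n (x : 'rV[R]_n) j : dotrv (delta_mx ord0 j) x = x ord0 j.
Proof.
rewrite /dotrv (bigD1 j) //= big1 => [|i ij].
  by rewrite mxE !eqxx mul1r addr0.
by rewrite mxE (negbTE ij) andbF mul0r.
Qed.

Lemma dotrv_le_norm n (w v : 'rV[R]_n) r :
  `|v| <= r -> `|dotrv w v| <= (\sum_k `|w ord0 k|) * r.
Proof.
move=> vr; apply: le_trans (ler_norm_sum _ _ _) _; rewrite mulr_suml.
apply: ler_sum => k _; rewrite normrM ler_wpM2l //.
exact: le_trans (coord_le_norm _ _) vr.
Qed.

Section Alternative.
Variables (T : normedModType R) (n : nat).
Variables (C : set 'rV[R]_(n + 1)) (Y : set T) (g : T -> 'rV[R]_n -> R).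
Hypotheses (closedC : closed C) (coneC : cvxcone C).
Hypotheses (compactY : compact Y) (cvxY : cvxset Y).
Hypothesis g_affine : forall y1 y2 t x,
  g ((1 - t) *: y1 + t *: y2) x = (1 - t) * g y1 x + t * g y2 x.
Hypothesis g_continuous : forall x, continuous (g^~ x).
Hypothesis g_subgradient : forall y x, Y y ->
  exists u, forall x', g y x + dotrv u (x' - x) <= g y x'.

(** [E y] is the epigraph of the conjugate of [g y], and [S] is the sum of [C] and the union of
    these epigraphs over [Y]. *)
Let E y (e : 'rV[R]_(n + 1)) := forall x, dotrv (slice x) e <= g y x.
Let S := [set v | exists y e c, [/\ Y y, E y e, C c & v = e + c]].

Let cvxS : cvxset S.
Proof.
case: coneC => _ CD CZ.
move=> _ _ t [y1 [e1 [c1 [Y1 E1 C1 ->]]]] [y2 [e2 [c2 [Y2 E2 C2 ->]]]] t0 t1.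
exists ((1 - t) *: y1 + t *: y2), ((1 - t) *: e1 + t *: e2).
exists ((1 - t) *: c1 + t *: c2); split.
- exact: cvxY.
- move=> x; rewrite g_affine dotrvDr !dotrvZr.
  by rewrite lerD // ler_wpM2l // subr_ge0.
- by apply: CD; apply: CZ; rewrite // subr_ge0.
- by rewrite !scalerDr addrACA.
Qed.

Let g_bounded x : exists M, forall y, Y y -> g y x <= M.
Proof.
have [Y0|Y0] := pselect (Y !=set0); last by exists 0 => y Yy; case: Y0; exists y.
have [y Yy ymax] := compact_max Y0 compactY (@g_continuous x).
by exists (g y x).
Qed.

(** A bounded piece of the union of the epigraphs is the projection, along the compact [Y], of a
    closed subset of [Y] times a ball. *)
Let closedE b : compact [set e | `|e| <= b /\ exists2 y, Y y & E y e].
Proof.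
pose P := (Y `*` [set e : 'rV[R]_(n + 1) | `|e| <= b]) `&`
  \bigcap_x [set p : T * 'rV[R]_(n + 1) | dotrv (slice x) p.2 - g p.1 x <= 0].
have -> : [set e | `|e| <= b /\ exists2 y, Y y & E y e] = [set p.2 | p in P].
  apply/seteqP; split=> [e [eb [y Yy Ey]]|_ [[y e] [[/= Yy eb] Ee] <-]].
    by exists (y, e) => //; split=> // x _; rewrite /= subr_le0; exact: Ey.
  by split=> //; exists y => // x; have := Ee x I; rewrite /= subr_le0.
apply: continuous_compact; first by apply: continuous_subspaceT => p; exact: cvg_snd.
apply: compact_closedI.
  apply: compact_setX => //; apply: (@bounded_rv_compact _ _ _ b) => //.
  exact: (closed_preimage (@norm_continuous _ _) (@closed_le _ b)).
apply: closed_bigI => x _.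
pose h (p : T * 'rV[R]_(n + 1)) := dotrv (slice x) p.2 - g p.1 x.
apply: (@closed_preimage _ _ h [set r | r <= 0] _ (@closed_le _ 0)) => p.
apply: cvgB.
  apply: (@cvg_comp _ _ _ snd (dotrv (slice x)) _ (nbhs p.2)).
    exact: cvg_snd.
  exact: dotrv_continuous.
apply: (@cvg_comp _ _ _ fst (g^~ x) _ (nbhs p.1)); first exact: cvg_fst.
exact: g_continuous.
Qed.

(* Testing an element e + c of [S] against [slice x0] and [slice (x0 +- e_j)]
   bounds e in terms of e + c. *)
Let bounded_parts x0 r : (forall c, C c -> dotrv (slice x0) c <= 0) ->
  exists b, forall y e c, Y y -> E y e -> C c -> `|e + c| <= r -> `|e| <= b.
Proof.
move=> Cx0; have [M gM] := choice g_bounded.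
pose k := (\sum_i `|slice x0 ord0 i|) * r.
pose d j : 'rV[R]_n := delta_mx ord0 j.
(* Comparing the upper bounds at x0 +- e_j with the lower bound -|k| at x0 gives |u_j| <= b1; the
   two bounds at x0 then give |s| <= b2. *)
pose b1 := \sum_j (`|M (x0 + d j)| + `|M (x0 - d j)|) + `|k|.
pose b2 := (\sum_i `|x0 ord0 i|) * b1 + `|k| + `|M x0|.
exists (b1 + b2) => y e c Yy Ee Cc ecr.
have lo : - `|k| <= dotrv (slice x0) e.
  have := dotrv_le_norm (slice x0) ecr; rewrite -/k dotrvDr.
  by have := Cx0 c Cc; have := ler_norm k; rewrite ler_norml; lra.
rewrite -[e]hsubmxK in lo Ee *.
set u := lsubmx e in lo Ee *; set s := rsubmx e in lo Ee *.
have hi x : dotrv x u - s ord0 ord0 <= M x.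
  by rewrite -dotrv_slice; apply: le_trans (Ee x) (gM _ _ Yy).
rewrite dotrv_slice in lo.
have b10 : 0 <= b1 by rewrite addr_ge0 // sumr_ge0 // => j _; rewrite addr_ge0.
have ub1 : `|u| <= b1.
  apply: norm_le_coord => // j; rewrite /b1 (bigD1 j) //=.
  have s0 : 0 <= \sum_(i < n | i != j) (`|M (x0 + d i)| + `|M (x0 - d i)|).
    by rewrite sumr_ge0 // => i _; rewrite addr_ge0.
  have h1 := hi (x0 - d j); have h2 := hi (x0 + d j).
  rewrite dotrvC dotrvBr ![dotrv u _]dotrvC dotrv_delta in h1.
  rewrite dotrvDl dotrv_delta in h2.
  have h3 := ler_norm (M (x0 + d j)); have h4 := ler_norm (M (x0 - d j)).
  have h5 := normr_ge0 (M (x0 + d j)); have h6 := normr_ge0 (M (x0 - d j)).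
  have h7 := normr_ge0 k.
  move: s0; set z3 := \sum_(i < n | _) _ => s0.
  by rewrite ler_norml; apply/andP; split; lra.
have sb2 : `|s ord0 ord0| <= b2.
  have := dotrv_le_norm x0 ub1; rewrite -/b1 /b2.
  have := hi x0; have := ler_norm (M x0); have := normr_ge0 (M x0).
  have := normr_ge0 k; rewrite !ler_norml => h1 h2 h3 h4 /andP[h5 h6].
  by apply/andP; split; lra.
have b20 : 0 <= b2 by exact: le_trans sb2.
apply: norm_le_coord => [|i]; first exact: addr_ge0.
rewrite -(splitK i); case: (split i) => j /=.
  rewrite row_mxEl; apply: le_trans (coord_le_norm _ _) _; apply: le_trans ub1 _.
  by rewrite lerDl.
by rewrite row_mxEr (ord1 j) (le_trans sb2) // lerDr.
Qed.

(** Near q both summands stay in compact sets, by [bounded_parts], and the sum of two compact sets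
    is closed. *)
Let closedS x0 : (forall c, C c -> dotrv (slice x0) c <= 0) -> closed S.
Proof.
move=> Cx0 q qcl; have [b Eb] := bounded_parts (`|q| + 1) Cx0.
pose E1 := [set e | `|e| <= b /\ exists2 y, Y y & E y e].
pose C1 := C `&` [set c | `|c| <= `|q| + 1 + b].
have cC1 : compact C1.
  apply: (@bounded_rv_compact _ _ _ (`|q| + 1 + b)); last by move=> u [].
  exact: (closedI closedC (closed_preimage (@norm_continuous _ _) (@closed_le _ _))).
have : closed [set p.1 + p.2 | p in E1 `*` C1].
  apply: compact_closed; first exact: norm_hausdorff.
  apply: continuous_compact; last by apply: compact_setX => //; exact: closedE.
  by apply: continuous_subspaceT; exact: add_continuous.
move=> /(_ q); case=> [B Bq|[e c] [[/= eb [y Yy Ee]] [Cc _]] <-]; last by exists y, e, c.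
have [|_ [[y [e [c [Yy Ee Cc ->]]]] [Bec qec]]] := qcl (B `&` ball q 1).
  by apply: filterI => //; exact: nbhsx_ballx.
have ecq : `|e + c| <= `|q| + 1.
  move: qec; rewrite -ball_normE /= distrC => qec.
  rewrite -[e + c](subrK q); apply: le_trans (ler_normD _ _) _.
  by rewrite addrC lerD2l ltW.
have eb := Eb _ _ _ Yy Ee Cc ecq.
exists (e + c); split=> //; exists (e, c) => //; split; first by split=> //; exists y.
split=> //=; rewrite -[c](addKr e) addrC; apply: le_trans (ler_normB _ _) _.
exact: lerD.
Qed.

(** The conclusion says that 0 lies in [S]. Otherwise a separating w, once its last coordinate is
    made positive, is a negative multiple of [slice z] for a point z that satisfies the constraints
    and has g y z bounded above by one negative number for all y in [Y]. *)
Lemma cone_alternative x0 :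
  (forall c, C c -> dotrv (slice x0) c <= 0) ->
  (forall x, (forall c, C c -> dotrv (slice x) c <= 0) ->
     forall e, 0 < e -> exists2 y, Y y & - e < g y x) ->
  exists y u r, [/\ Y y, C (row_mx u (const_mx r)) &
    forall x, r - dotrv x u <= g y x].
Proof.
move=> Cx0 gpos; case: coneC => C0 CD CZ.
have [[y [e [c [Yy Ee Cc ec0]]]]|nS0] := pselect (S 0).
  have ce : e = - c by apply/eqP; rewrite -subr_eq0 opprK -ec0.
  exists y, (lsubmx c), (rsubmx c ord0 ord0); split=> // [|x].
    rewrite (_ : const_mx _ = rsubmx c) ?hsubmxK //.
    by apply/matrixP=> i j; rewrite !ord1 mxE.
  have := Ee x; rewrite ce -scaleN1r dotrvZr -[c in dotrv _ c]hsubmxK.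
  by rewrite dotrv_slice mulN1r opprB.
(* The equality case of Fenchel's inequality: a subgradient of g y at x gives a point of the
   epigraph that touches at x. *)
have tangent y x : Y y -> exists2 e, E y e & dotrv (slice x) e = g y x.
  move=> /(g_subgradient x)[u gu].
  exists (row_mx u (const_mx (dotrv u x - g y x))) => [x'|].
    have := gu x'; rewrite dotrvBr dotrv_slice mxE (dotrvC x'); lra.
  by rewrite dotrv_slice mxE (dotrvC x); lra.
have [y0 Yy0 _] := gpos x0 Cx0 1 ltr01.
have [e0 Ee0 _] := tangent y0 x0 Yy0.
have [|w [dl [dl0 wS]]] := separation0 (closedS Cx0) cvxS _ nS0.
  by exists (e0 + 0), y0, e0, 0.
have wE y e : Y y -> E y e -> dl <= dotrv w e.
  by move=> Yy Ee; apply: wS; exists y, e, 0; rewrite addr0.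
have wC c : C c -> 0 <= dotrv w c.
  move=> Cc; rewrite leNgt; apply/negP => wc.
  pose a := - dotrv w e0 / dotrv w c.
  have a0 : 0 <= a.
    rewrite /a mulNr oppr_ge0 pmulr_rle0 ?invr_le0 ?ltW //.
    exact: lt_le_trans dl0 (wE _ _ Yy0 Ee0).
  have : dl <= dotrv w (e0 + a *: c).
    by apply: wS; exists y0, e0, (a *: c); split=> //; exact: CZ.
  by rewrite dotrvDr dotrvZr /a divfK ?lt_eqF // subrr leNgt dl0.
pose s := rsubmx w ord0 ord0.
have wrow : w = row_mx (lsubmx w) (const_mx s).
  rewrite -[LHS]hsubmxK; congr row_mx.
  by apply/matrixP=> i j; rewrite !ord1 [RHS]mxE.
(* The epigraphs are unbounded upward, so the last coordinate of w cannot be negative. *)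
have s0 : 0 <= s.
  rewrite leNgt; apply/negP => sneg.
  pose a := - dotrv w e0 / s.
  have a0 : 0 <= a.
    rewrite /a mulNr oppr_ge0 pmulr_rle0 ?invr_le0 ?ltW //.
    exact: lt_le_trans dl0 (wE _ _ Yy0 Ee0).
  have : dl <= dotrv w (e0 + row_mx 0 (const_mx a)).
    apply: (wE y0) => // x; rewrite dotrvDr dotrv_slice dotrv0r mxE.
    by have := Ee0 x; lra.
  rewrite dotrvDr [X in _ + dotrv X _]wrow dotrv_row_mx dotrv0r /dotrv.
  rewrite big_ord1 !mxE add0r /a mulrC divfK ?lt_eqF //.
  by rewrite -/(dotrv w e0) subrr leNgt dl0.
have [M gM] := g_bounded x0.
(* If s = 0, w is not a multiple of any slice. Subtracting t times [slice x0] makes the last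
   coordinate s + t > 0, with t so small that at most dl / 2 of the separation is lost. *)
pose t := dl / (2 * (`|M| + 1)).
have M0 := normr_ge0 M; have M1 := ler_norm M.
have t0 : 0 < t by rewrite divr_gt0 //; lra.
have tM : t * M <= dl / 2.
  rewrite /t mulrAC ler_pdivrMr; last by lra.
  by rewrite mulrA divfK //; nra.
pose z := (- (s + t)^-1) *: (lsubmx w - t *: x0).
have st0 : 0 < s + t by lra.
have zE v : dotrv w v - t * dotrv (slice x0) v = - (s + t) * dotrv (slice z) v.
  rewrite [w in LHS]wrow -[v]hsubmxK !dotrv_slice dotrv_row_mx /z.
  rewrite dotrvZl (dotrvC (_ - _)) dotrvBr dotrvZr !(dotrvC (lsubmx v)).
  rewrite [dotrv (const_mx s) _]/dotrv big_ord1 [const_mx s _ _]mxE.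
  by field; rewrite gt_eqF.
have [c Cc||y Yy gy] := gpos z _ (dl / (2 * (s + t))).
- have := zE c; have := wC c Cc; have := Cx0 c Cc => h1 h2 h3.
  rewrite -oppr_ge0 -(pmulr_rge0 _ st0) mulrN -mulNr -h3 subr_ge0.
  by apply: le_trans h2; rewrite pmulr_rle0.
- by rewrite divr_gt0 // mulr_gt0.
have [e Ee ze] := tangent y z Yy.
have := zE e; rewrite ze => h1.
have h2 := wE _ _ Yy Ee.
have h3 : t * dotrv (slice x0) e <= dl / 2.
  apply: le_trans tM; rewrite ler_pM2l //; exact: le_trans (Ee x0) (gM _ Yy).
have : dl / (2 * (s + t)) * (s + t) = dl / 2 by field; rewrite gt_eqF.
move: gy; set D := dl / (2 * _) => gy hD; nra.
Qed.

End Alternative.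
End ConeAlternative.

Lemma dotrv_affine_continuous {R : realType} N (u : 'rV[R]_N) (a : R) :
  continuous (fun v : 'rV[R]_N => a + dotrv u v).
Proof.
move=> v; apply: (@continuousD _ _ _ (fun=> a) (dotrv u) v).
  exact: cst_continuous.
exact: dotrv_continuous.
Qed.

(** * SOS-convex semi-algebraic functions *)

Section SosConvexity.
Context {R : realType} {n : nat}.
Implicit Types p q : {mpoly R[n]}.

Lemma hessianD p q : hessian (p + q) = hessian p + hessian q.
Proof. by apply/matrixP=> i j; rewrite !mxE !mderivD. Qed.

Lemma hessianZ a p : hessian (a *: p) = a%:MP *: hessian p.
Proof. by apply/matrixP=> i j; rewrite !mxE !mderivZ mul_mpolyC. Qed.

Lemma sos_convex0 : sos_convex (0 : {mpoly R[n]}).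
Proof.
exists 0%N, 0; rewrite mul0mx.
by apply/matrixP=> i j; rewrite !mxE !mderiv0.
Qed.

Lemma sos_convexD p q : sos_convex p -> sos_convex q -> sos_convex (p + q).
Proof.
move=> [r [F hF]] [s [G hG]]; exists (r + s)%N, (row_mx F G).
by rewrite tr_row_mx mul_row_col -hF -hG hessianD.
Qed.

Lemma sos_convexZ a p : 0 <= a -> sos_convex p -> sos_convex (a *: p).
Proof.
move=> a0 [r [F hF]]; exists r, ((Num.sqrt a)%:MP *: F).
rewrite linearZ /= -scalemxAl -scalemxAr scalerA -hF hessianZ -mpolyCM -expr2.
by rewrite sqr_sqrtr.
Qed.

Lemma sos_convex_sum (I : finType) (q : I -> {mpoly R[n]}) :
  (forall i, sos_convex (q i)) -> sos_convex (\sum_i q i).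
Proof.
move=> qc; elim/big_ind: _ => [|p1 p2|i _]; first exact: sos_convex0.
  exact: sos_convexD.
exact: qc.
Qed.

End SosConvexity.

Section SossaData.
Context {R : realType} {n : nat}.
Implicit Types (D : sossa_data R n) (x : 'rV[R]_n).

Lemma linear_hpoly (L : {linear {mpoly R[n]} -> R | *%R}) D y :
  L (hpoly y) = L (h0 D) + \sum_j y ord0 j * L (hcoef D j).
Proof.
rewrite /hpoly linearD linear_sum; congr (_ + _).
by apply: eq_bigr => j _; rewrite linearZ.
Qed.

Lemma peval_hpoly D y x : peval (hpoly y) x =
  peval (h0 D) x + \sum_j y ord0 j * peval (hcoef D j) x.
Proof. exact: linear_hpoly. Qed.

Lemma peval_hpoly_affine D (y1 y2 : 'rV[R]_(sdim D)) t x :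
  peval (hpoly ((1 - t) *: y1 + t *: y2)) x =
  (1 - t) * peval (hpoly y1) x + t * peval (hpoly y2) x.
Proof.
rewrite !peval_hpoly; under eq_bigr do rewrite !mxE mulrDl -!mulrA.
rewrite big_split -!mulr_sumr /=; ring.
Qed.

Lemma peval_hpoly_continuous D x :
  continuous (fun y : 'rV[R]_(sdim D) => peval (hpoly y) x).
Proof.
pose c := \row_j peval (hcoef D j) x.
have -> : (fun y => peval (hpoly y) x) = (fun y => peval (h0 D) x + dotrv c y).
  apply/funext => y; rewrite peval_hpoly; congr (_ + _).
  by apply: eq_bigr => j _; rewrite mxE mulrC.
exact: dotrv_affine_continuous.
Qed.

Lemma lmi_affine D (y1 y2 : 'rV[R]_(sdim D)) z1 z2 t :
  lmi ((1 - t) *: y1 + t *: y2) ((1 - t) *: z1 + t *: z2) =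
  (1 - t) *: lmi y1 z1 + t *: lmi y2 z2.
Proof.
have sumE (I : finType) (M : I -> 'M[R]_(tdim D)) (a b : I -> R) :
    \sum_i ((1 - t) * a i + t * b i) *: M i =
    (1 - t) *: \sum_i a i *: M i + t *: \sum_i b i *: M i.
  rewrite !scaler_sumr -big_split; apply: eq_bigr => i _.
  by rewrite scalerDl !scalerA.
rewrite /lmi; under eq_bigr do rewrite !mxE.
under [X in _ + X]eq_bigr do rewrite !mxE.
have A0E : A0 D = (1 - t) *: A0 D + t *: A0 D by rewrite -scalerDl subrK scale1r.
by rewrite !sumE !scalerDr {1}A0E [X in X + _ = _]addrACA [LHS]addrACA.
Qed.

Lemma cvxset_Omega D : cvxset (Omega D).
Proof.
move=> y1 y2 t [z1 p1] [z2 p2] t0 t1; exists ((1 - t) *: z1 + t *: z2).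
by rewrite lmi_affine; apply: psdmxD; apply: psdmxZ; rewrite // subr_ge0.
Qed.

Variables (d : nat) (D : sossa_data R n) (okD : sossa_ok d D).

Lemma sossa_fun_attained x : exists y, [/\ Omega D y,
  sossa_fun D x = peval (hpoly y) x &
  forall y', Omega D y' -> peval (hpoly y') x <= peval (hpoly y) x].
Proof.
have [_ _ _ D0 cD] := okD.
have [y Dy ymax] := compact_max D0 cD (@peval_hpoly_continuous D x).
exists y; split=> //; apply/eqP; rewrite eq_le; apply/andP; split.
  by apply: ge_sup => [|_ [y' /ymax ? <-]//]; exists (peval (hpoly y) x), y.
apply: ub_le_sup; last by exists y.
by exists (peval (hpoly y) x) => _ [y' /ymax ? <-].
Qed.

Lemma peval_hpoly_le_sossa x y : Omega D y -> peval (hpoly y) x <= sossa_fun D x.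
Proof. by have [y0 [_ -> ymax]] := sossa_fun_attained x; exact: ymax. Qed.

Lemma msize_hpoly y : (msize (@hpoly R n D y) <= (2 * d).+1)%N.
Proof.
have [[h0d hd] _ _ _ _] := okD.
apply: leq_trans (mmeasureD_le _ _ _) _; rewrite geq_max h0d /=.
by apply: msize_sum_le => j _; apply: leq_trans (msizeZ_le _ _) (hd j).
Qed.

Lemma mxinner_lmi y z (Z : 'M[R]_(tdim D)) : mxinner (lmi y z) Z =
  mxinner (A0 D) Z + \sum_j y ord0 j * mxinner (Acoef D j) Z
  + \sum_l z ord0 l * mxinner (Bcoef D l) Z.
Proof.
rewrite /lmi !mxinnerDl !mxinner_suml.
by congr (_ + _ + _); apply: eq_bigr => i _; rewrite mxinnerZl.
Qed.

Lemma sdp_weak_duality (L : {linear {mpoly R[n]} -> R | *%R}) Z y :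
  psdmx Z -> (forall j, L (hcoef D j) + mxinner (Acoef D j) Z = 0) ->
  (forall l, mxinner (Bcoef D l) Z = 0) -> Omega D y ->
  L (hpoly y) <= L (h0 D) + mxinner (A0 D) Z.
Proof.
move=> pZ hA hB [z pyz]; have := mxinner_psd_ge0 pyz pZ.
rewrite mxinner_lmi linear_hpoly [X in _ + X]big1 => [|l _]; last by rewrite hB mulr0.
have -> : \sum_j y ord0 j * L (hcoef D j) =
    - \sum_j y ord0 j * mxinner (Acoef D j) Z.
  rewrite -sumrN; apply: eq_bigr => j _; rewrite -mulrN; congr (_ * _).
  by apply/eqP; rewrite -addr_eq0 hA.
lra.
Qed.

(** [sdp_farkas] is applied to A_0, A_j, B_l with right-hand sides f(x) - h_0(x), -h_j(x), 0.
    Slater's condition gives its closedness hypothesis, since a psd matrix orthogonal to a positive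
    definite one is 0. *)
Lemma sdp_strong_duality x :
  (exists (y : 'rV[R]_(sdim D)) (z : 'rV[R]_(pdim D)), pdmx (lmi y z)) ->
  exists Z, [/\ psdmx Z, peval (h0 D) x + mxinner (A0 D) Z = sossa_fun D x,
    forall j, peval (hcoef D j) x + mxinner (Acoef D j) Z = 0 &
    forall l, mxinner (Bcoef D l) Z = 0].
Proof.
move=> [ys [zs ps]]; have [_ _ [sA0 sA sB] _ _] := okD.
have [y0 [[z0 py0] fy0 ymax]] := sossa_fun_attained x.
pose I := ('I_1 + ('I_(sdim D) + 'I_(pdim D)))%type.
pose G (a : I) := match a with
  | inl _ => A0 D | inr (inl j) => Acoef D j | inr (inr l) => Bcoef D l end.
pose b (a : I) := match a with
  | inl _ => sossa_fun D x - peval (h0 D) x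
  | inr (inl j) => - peval (hcoef D j) x | inr (inr l) => 0 end.
have [|Z pZ GZ|w pw|Z pZ GZ] := @sdp_farkas R I _ G b.
- by case=> [i|[j|l]] /=.
- apply: mxinner_pd_eq0 ps pZ _; rewrite mxinner_lmi (GZ (inl ord0)) add0r.
  rewrite !big1 ?addr0 // => i _.
    by rewrite (GZ (inr (inr i))) mulr0.
  by rewrite (GZ (inr (inl i))) mulr0.
- rewrite !big_sumType !big_ord1 /= in pw *.
  (* The coefficient w0 of A_0 may have any sign. Adding N times the psd matrix at the maximizer
     (y0, z0) raises it to k > 0; division by k then gives a point of Omega, where the value is at
     most the maximum. *)
  set w0 := w _ in pw *; pose N := `|w0| + 1; pose k := w0 + N.
  have N0 : 0 <= N by rewrite addr_ge0.
  have k0 : 0 < k by rewrite /k /N; have := ler_norm (- w0); rewrite normrN; lra.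
  pose y := k^-1 *: (\row_j w (inr (inl j)) + N *: y0).
  pose z := k^-1 *: (\row_l w (inr (inr l)) + N *: z0).
  have : Omega D y.
    exists z; rewrite (_ : lmi y z = k^-1 *: (w0 *: A0 D +
      (\sum_j w (inr (inl j)) *: Acoef D j + \sum_l w (inr (inr l)) *: Bcoef D l)
      + N *: lmi y0 z0)); last first.
      have sumE (J : finType) (M : J -> 'M[R]_(tdim D)) (c e : J -> R) :
          \sum_i (k^-1 * (c i + N * e i)) *: M i =
          k^-1 *: (\sum_i c i *: M i + N *: \sum_i e i *: M i).
        rewrite !scaler_sumr -big_split scaler_sumr; apply: eq_bigr => i _ /=.
        by rewrite -scalerA scalerDl scalerA.
      have A0E : A0 D = k^-1 *: (w0 *: A0 D + N *: A0 D).
        by rewrite -scalerDl scalerA mulVf ?scale1r // gt_eqF.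
      rewrite /lmi; under eq_bigr do rewrite !mxE.
      under [X in _ + X]eq_bigr do rewrite !mxE.
      rewrite !sumE {1}A0E -!scalerDr; congr (_ *: _).
      by rewrite !scalerDr [X in _ = X + _]addrA [RHS]addrACA [X in _ = X + _]addrACA.
    apply: psdmxZ; first by rewrite invr_ge0 ltW.
    by apply: psdmxD => //; exact: psdmxZ.
  move=> /ymax; rewrite -(ler_pM2l k0) !peval_hpoly !mulrDr lerD2l.
  have -> : k * \sum_j y ord0 j * peval (hcoef D j) x =
      \sum_j w (inr (inl j)) * peval (hcoef D j) x
      + N * \sum_j y0 ord0 j * peval (hcoef D j) x.
    rewrite !mulr_sumr -big_split; apply: eq_bigr => j _ /=.
    by rewrite !mxE; field; rewrite gt_eqF.
  rewrite fy0 peval_hpoly [X in _ + (_ + X)]big1 => [|l _]; last by rewrite mulr0.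
  have -> : \sum_j w (inr (inl j)) * - peval (hcoef D j) x =
      - \sum_j w (inr (inl j)) * peval (hcoef D j) x.
    by rewrite -sumrN; apply: eq_bigr => j _; rewrite mulrN.
  rewrite /k; lra.
exists Z; split=> // [|j|l].
- by rewrite (GZ (inl ord0)) /= addrC subrK.
- by rewrite (GZ (inr (inl j))) /= subrr.
- by rewrite (GZ (inr (inr l))).
Qed.

End SossaData.

(** * The fractional program *)

Section FractionalDuality.
Context {R : realType} {n d m : nat}.
Variable f : 'I_(m + 2) -> sossa_data R n.
Hypothesis hf : forall i, sossa_ok d (f i).

Lemma sum_ix (V : nmodType) (F : 'I_(m + 2) -> V) :
  \sum_i F i = \sum_(i < m) F (cix i) + F (numix m) + F (denix m).
Proof.
rewrite big_split_ord /= -addrA; congr (_ + _).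
rewrite big_ord_recl big_ord1; congr (_ + F _).
by apply: val_inj.
Qed.

Lemma ix_ind (P : 'I_(m + 2) -> Prop) :
  (forall i, P (cix i)) -> P (numix m) -> P (denix m) -> forall i, P i.
Proof.
move=> Pc Pn Pd i; rewrite -(splitK i); case: (split i) => [j|j] /=; first exact: Pc.
have [->|j1] := eqVneq j ord0; first exact: Pn.
suff -> : j = ord_max by exact: Pd.
by apply: val_inj; case: j j1 => -[|[|]].
Qed.

(** L_y of the polynomial assembled from lambda is the pairing of the moment matrix with X, hence
    nonnegative, while the constraints on the Z_i bound it above by the objective minus
    lambda_0^{m+2}. *)
Lemma Q_weak_duality y Z lam0 lam z X :
  @Qfeas R n d m f y Z -> @Qhatfeas R n d m f lam0 lam z X ->
  lam0 (denix m) <= @Qobj R n d m f (y, Z).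
Proof.
move=> [pZ Zden Zc [hA hB] py] [hX plam lam1 [lamc lamd] pX].
have L0 : 0 <= \sum_i (lam0 i * Lfun y (h0 (f i)) +
    \sum_j lam i ord0 j * Lfun y (hcoef (f i) j)).
  have -> : \sum_i (lam0 i * Lfun y (h0 (f i)) +
    \sum_j lam i ord0 j * Lfun y (hcoef (f i) j)) =
    mxinner (\sum_a y a *: Bmx a) X.
    rewrite mxinner_suml; under [RHS]eq_bigr do rewrite mxinnerZl -hX mulr_sumr.
    rewrite exchange_big; apply: eq_bigr => i _ /=.
    under [RHS]eq_bigr do rewrite mulrDr mulr_sumr.
    rewrite big_split exchange_big /=; congr (_ + _).
      by rewrite /Lfun mulr_sumr; apply: eq_bigr => a _; ring.
    by apply: eq_bigr => j _; rewrite /Lfun mulr_sumr; apply: eq_bigr => a _; ring.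
  exact: mxinner_psd_ge0.
have Li i : lam0 i * Lfun y (h0 (f i)) +
    \sum_j lam i ord0 j * Lfun y (hcoef (f i) j) <=
    lam0 i * (Lfun y (h0 (f i)) + mxinner (A0 (f i)) (Z i)).
  have := mxinner_psd_ge0 (plam i) (pZ i).
  rewrite !mxinnerDl !mxinner_suml mxinnerZl.
  rewrite [X in _ + X]big1 => [|l _]; last by rewrite mxinnerZl hB mulr0.
  have -> : \sum_j mxinner (lam i ord0 j *: Acoef (f i) j) (Z i) =
      - \sum_j lam i ord0 j * Lfun y (hcoef (f i) j).
    rewrite -sumrN; apply: eq_bigr => j _; rewrite mxinnerZl -mulrN; congr (_ * _).
    by apply/eqP; rewrite -addr_eq0 addrC hA.
  lra.
have := le_trans L0 (ler_sum _ (fun i _ => Li i)).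
rewrite sum_ix lam1 mul1r -/(@Qobj R n d m f (y, Z)).
have : \sum_(i < m) lam0 (cix i) *
    (Lfun y (h0 (f (cix i))) + mxinner (A0 (f (cix i))) (Z (cix i))) <= 0.
  by apply: sumr_le0 => i _; exact: mulr_ge0_le0.
have : lam0 (denix m) * (1 + (Lfun y (h0 (f (denix m))) +
    mxinner (A0 (f (denix m))) (Z (denix m)))) <= 0.
  by apply: mulr_ge0_le0 => //; rewrite addrA.
rewrite /Qobj /= mulrDr mulr1; lra.
Qed.

Lemma FP_point_in_Q x :
  (forall i, exists (y : 'rV[R]_(sdim (f i))) (z : 'rV[R]_(pdim (f i))),
     pdmx (lmi y z)) ->
  FPset f x -> 0 < - sossa_fun (f (denix m)) x ->
  exists w, @Qset R n d m f w /\ @Qobj R n d m f w = FPobj f x.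
Proof.
move=> hslater Kx den0.
pose Zx i := cid (sdp_strong_duality (hf i) x (hslater i)).
(* The Charnes-Cooper scaling: t f_{m+2}(x) = -1 makes the denominator constraint tight, and t
   f_{m+1}(x) is the ratio. *)
pose t := (- sossa_fun (f (denix m)) x)^-1.
have t0 : 0 < t by rewrite invr_gt0.
pose y : {ffun expo n (2 * d) -> R} := t *: point_moments (2 * d) (x ord0).
pose Z i := t *: sval (Zx i).
have yE p : (msize p <= (2 * d).+1)%N -> Lfun y p = t * peval p x.
  move=> pd; rewrite /peval -(Lfun_point (x ord0) pd) /Lfun mulr_sumr.
  by apply: eq_bigr => a _; rewrite !ffunE; exact: mulrCA.
have vE i : Lfun y (h0 (f i)) + mxinner (A0 (f i)) (Z i) = t * sossa_fun (f i) x.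
  have [[hd _] _ _ _ _] := hf i.
  rewrite yE // mxinnerZr -mulrDr; congr (_ * _).
  by have [] := svalP (Zx i).
exists (y, Z); split; last first.
  by rewrite /Qobj /= vE mulrC.
split=> /= [i||||].
- by apply: psdmxZ; [exact: ltW|have [] := svalP (Zx i)].
- by rewrite -addrA vE -[sossa_fun _ _]opprK mulrN /t mulVf ?subrr // gt_eqF.
- by move=> i; rewrite vE mulr_ge0_le0 // ltW.
- split=> i j; have [_ _ hA hB] := svalP (Zx i).
    have [[_ hd] _ _ _ _] := hf i.
    by rewrite yE // mxinnerZr -mulrDr hA mulr0.
  by rewrite mxinnerZr hB mulr0.
- by apply: psd_momentsZ; [exact: ltW|exact: psd_point_moments].
Qed.

(** Jensen's inequality and weak duality for the inner supremum bound every f_i(x) by its expression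
    in (Q) divided by y_0. This gives feasibility, y_0 f_{m+1}(x) <= v and -y_0 f_{m+2}(x) >= 1,
    where v >= 0 is the objective value; so the ratio at x is at most v. *)
Lemma Q_minimizer_recovery y Z :
  (forall i, exists (y : 'rV[R]_(sdim (f i))) (z : 'rV[R]_(pdim (f i))),
     pdmx (lmi y z)) ->
  (forall x, FPset f x -> 0 <= sossa_fun (f (numix m)) x) ->
  (forall x, FPset f x -> 0 < - sossa_fun (f (denix m)) x) ->
  is_minimizer (@Qset R n d m f) (@Qobj R n d m f) (y, Z) ->
  y bm0 != 0 ->
  is_minimizer (FPset f) (FPobj f)
    ((y bm0)^-1 *: \row_(k < n) Lfun y 'X_k).
Proof.
move=> hslater hnum hden [[/= pZ Zden Zc [hA hB] py] ymin] y0n.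
set x := _ *: _.
have y0 : 0 < y bm0.
  rewrite lt_def y0n -Lfun1 -[1]mulr1.
  by apply: (Lfun_sos py); rewrite msize1.
have fx i : sossa_fun (f i) x <=
    (y bm0)^-1 * (Lfun y (h0 (f i)) + mxinner (A0 (f i)) (Z i)).
  have [yi [Oyi -> _]] := sossa_fun_attained (hf i) x.
  rewrite ler_pdivlMl //; have [_ hc _ _ _] := hf i.
  apply: le_trans (sdp_weak_duality (L := Lfun y) (pZ i) (hA i) (hB i) Oyi).
  have := Lfun_jensen py y0 (msize_hpoly (hf i) yi) (hc _ Oyi).
  congr (_ * _ <= _); apply: meval_eq => k; rewrite !mxE.
  by [].
have Kx : FPset f x.
  move=> i; apply: le_trans (fx _) _; apply: mulr_ge0_le0; last exact: Zc.
  by rewrite invr_ge0 ltW.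
split=> // x' Kx'; have [w [Qw <-]] := FP_point_in_Q hslater Kx' (hden _ Kx').
apply: le_trans (ymin _ Qw); rewrite /FPobj ler_pdivrMr ?hden //.
have := fx (numix m); rewrite -/(Qobj (y, Z)) ler_pdivlMl // => fn.
have /(ler_wpM2l (ltW y0)) := fx (denix m).
rewrite mulrA divff // mul1r => fd.
have fn0 := hnum _ Kx.
have Q0 : 0 <= @Qobj R n d m f (y, Z).
  by apply: le_trans fn; rewrite mulr_ge0 // ltW.
rewrite -(ler_pM2l y0); apply: le_trans fn _; rewrite mulrCA.
rewrite -[leLHS]mulr1 ler_wpM2l // mulrN; lra.
Qed.

Lemma epi_conjugateP (phi : 'rV[R]_n -> R) u r :
  epi (conjugate (fun x => (phi x)%:E)) (u, r) <->
  forall x, dotrv u x - phi x <= r.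
Proof.
rewrite /epi /conjugate /=; split=> [h x|h].
  rewrite -lee_fin; apply: le_trans h; apply: ereal_sup_ubound.
  by exists x.
by apply: ge_ereal_sup => _ [x _ <-]; rewrite lee_fin; exact: h.
Qed.

(** The cone C of the theorem in row vectors of length n + 1, the form in which [cone_alternative]
    takes it. *)
Definition cone_rV : set 'rV[R]_(n + 1) :=
  [set v | epicone f (lsubmx v, rsubmx v ord0 ord0)].

Lemma cone_rVP v : cone_rV v <->
  exists (y : forall i : 'I_m, 'rV[R]_(sdim (f (cix i)))) (lam : 'I_m -> R),
    [/\ forall i, Omega (f (cix i)) (y i), forall i, 0 <= lam i &
      forall x, dotrv (slice x) v <= \sum_i lam i * peval (hpoly (y i)) x].
Proof.
have E y lam x : (dotrv (slice x) v <= \sum_i lam i * peval (hpoly (y i)) x) =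
   (dotrv (lsubmx v) x - peval (\sum_(i < m) lam i *: @hpoly R n (f (cix i)) (y i)) x
     <= rsubmx v ord0 ord0).
  rewrite -[v in LHS]hsubmxK dotrv_slice dotrvC.
  have -> : peval (\sum_i lam i *: hpoly (y i)) x =
      \sum_i lam i * peval (hpoly (y i)) x.
    by rewrite /peval raddf_sum; apply: eq_bigr => i _; rewrite /= mevalZ.
  by rewrite !lerBlDr addrC.
split=> -[y [lam [yO lam0 h]]]; exists y, lam; split=> //.
  by move/epi_conjugateP: h => h x; rewrite E.
by apply/epi_conjugateP => x; rewrite -E.
Qed.

Lemma closed_cone_rV : closed (epicone f) -> closed cone_rV.
Proof.
apply: closed_preimage => v.
have cl : continuous (fun w : 'rV[R]_(n + 1) => lsubmx w).
  apply: mx_continuous => i j.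
  rewrite (_ : (fun _ => _) = fun w : 'rV[R]_(n + 1) => w i (lshift 1 j)).
    exact: coord_continuous.
  by apply/funext => w; rewrite mxE.
have cr : continuous (fun w : 'rV[R]_(n + 1) => rsubmx w ord0 ord0).
  rewrite (_ : (fun _ => _) = fun w : 'rV[R]_(n + 1) => w ord0 (rshift n ord0)).
    exact: coord_continuous.
  by apply/funext => w; rewrite mxE.
exact: (cvg_pair (cl v) (cr v)).
Qed.

Lemma Omega_choice : exists y : forall i : 'I_m, 'rV[R]_(sdim (f (cix i))),
  forall i, Omega (f (cix i)) (y i).
Proof.
have O i : exists y, Omega (f (cix i)) y by have [] := hf (cix i).
by exists (fun i => sval (cid (O i))) => i; exact: (svalP (cid (O i))).
Qed.

Lemma cvxcone_cone_rV : cvxcone cone_rV.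
Proof.
split.
- have [y yO] := Omega_choice; apply/cone_rVP; exists y, (fun=> 0); split=> // x.
  by rewrite dotrv0r big1 // => i _; rewrite mul0r.
- move=> u v /cone_rVP[y1 [l1 [O1 p1 h1]]] /cone_rVP[y2 [l2 [O2 p2 h2]]].
  apply/cone_rVP.
  (* Multipliers add and parameters are averaged with weights l1 / (l1 + l2) and l2 / (l1 + l2), as
     h is affine in y; if both multipliers are 0, division by zero yields y1. *)
  pose y i := (1 - l2 i / (l1 i + l2 i)) *: y1 i + (l2 i / (l1 i + l2 i)) *: y2 i.
  exists y, (fun i => l1 i + l2 i); split=> [i|i|x]; last 1 first.
  + rewrite dotrvDr; apply: le_trans (lerD (h1 x) (h2 x)) _.
    rewrite -big_split; apply: ler_sum => i _ /=; rewrite peval_hpoly_affine.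
    have [l0|ln0] := eqVneq (l1 i + l2 i) 0.
      have := p1 i; have := p2 i => ? ?.
      have -> : l1 i = 0 by lra.
      have -> : l2 i = 0 by lra.
      by rewrite !mul0r addr0 mul0r.
    by rewrite le_eqVlt; apply/predU1P; left; field.
  + have l120 : 0 <= l1 i + l2 i by rewrite addr_ge0.
    apply: cvxset_Omega => //; first by rewrite divr_ge0.
    have [->|ln0] := eqVneq (l1 i + l2 i) 0; first by rewrite invr0 mulr0.
    by rewrite ler_pdivrMr ?lt_def ?ln0 // mul1r lerDr.
  + by rewrite addr_ge0.
- move=> a u a0 /cone_rVP[y [l [Oy p h]]]; apply/cone_rVP.
  exists y, (fun i => a * l i); split=> // [i|x]; first by rewrite mulr_ge0.
  rewrite dotrvZr; under eq_bigr do rewrite -mulrA.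
  by rewrite -mulr_sumr ler_wpM2l.
Qed.

Lemma hpoly_subgradient i (y : 'rV[R]_(sdim (f i))) x : Omega (f i) y ->
  exists u, forall x', peval (hpoly y) x + dotrv u (x' - x) <= peval (hpoly y) x'.
Proof.
have [_ hc _ _ _] := hf i; move=> /hc yc.
exists (\row_k ((hpoly y)^`M(k)).@[x ord0]) => x'.
apply: le_trans (sos_convex_tangent (x ord0) (x' ord0) yc).
by rewrite lerD2l; apply: ler_sum => k _; rewrite !mxE.
Qed.

(** A constraint f_i(x) <= 0 is recovered from a single element of C: the subgradient at x of the
    polynomial active in f_i, whose pairing with [slice x] is f_i(x). *)
Lemma FPset_polar x :
  (forall c, cone_rV c -> dotrv (slice x) c <= 0) <-> FPset f x.
Proof.
split=> [h i|Kx c /cone_rVP[y [lam [Oy lam0 hc]]]]; last first.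
  apply: le_trans (hc x) _; apply: sumr_le0 => i _; apply: mulr_ge0_le0 => //.
  exact: le_trans (peval_hpoly_le_sossa (hf _) x (Oy i)) (Kx i).
have [yi [Oyi -> _]] := sossa_fun_attained (hf (cix i)) x.
have [u gu] := hpoly_subgradient x Oyi.
have [y0 Oy0] := Omega_choice.
(* Only constraint i gets a nonzero multiplier; the other parameters are arbitrary points of their
   Omega. *)
pose y := dfwith y0 yi.
have yE : y i = yi by exact: dfwith_in.
have Oy j : Omega (f (cix j)) (y j).
  rewrite /y; case: dfwithP => // j' _.
have := h (row_mx u (const_mx (dotrv u x - peval (hpoly yi) x))).
rewrite dotrv_slice mxE (dotrvC x) opprB addrCA subrr addr0; apply.
apply/cone_rVP; exists y, (fun j => (j == i)%:R); split=> // x'.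
rewrite (bigD1 i) //= big1 => [|j ji]; last by rewrite (negbTE ji) mul0r.
rewrite eqxx mul1r addr0 yE dotrv_slice mxE.
by have := gu x'; rewrite dotrvBr (dotrvC x'); lra.
Qed.

End FractionalDuality.

(** * Multipliers for a lower bound theta and exactness of the relaxation *)

Section ExactRelaxation.
Context {R : realType} {n d m : nat}.
Variable f : 'I_(m + 2) -> sossa_data R n.
Hypothesis hf : forall i, sossa_ok d (f i).

(** [cone_alternative] with Y = Omega_{m+1} x Omega_{m+2} and g = h^{m+1}_{y1} + theta h^{m+2}_{y2},
    which theta >= 0 keeps convex, finds the parameters and the multipliers in one separation. *)
Lemma fractional_multipliers theta : 0 <= theta -> FPset f !=set0 ->
  closed (epicone f) ->
  (forall x, FPset f x ->
     0 <= sossa_fun (f (numix m)) x + theta * sossa_fun (f (denix m)) x) ->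
  exists (y : forall i : 'I_m, 'rV[R]_(sdim (f (cix i)))) (lam : 'I_m -> R) y1 y2,
    [/\ forall i, Omega (f (cix i)) (y i) /\ 0 <= lam i,
        Omega (f (numix m)) y1, Omega (f (denix m)) y2 &
        forall x, 0 <= \sum_i lam i * peval (hpoly (y i)) x +
          peval (hpoly y1) x + theta * peval (hpoly y2) x].
Proof.
move=> th0 [x0 Kx0] ccl pos.
pose T : normedModType R :=
  ('rV[R]_(sdim (f (numix m))) * 'rV[R]_(sdim (f (denix m))))%type.
pose Y : set T := Omega (f (numix m)) `*` Omega (f (denix m)).
pose g (y : T) x := peval (hpoly y.1) x + theta * peval (hpoly y.2) x.
have cY : compact Y.
  have [_ _ _ _ c1] := hf (numix m); have [_ _ _ _ c2] := hf (denix m).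
  exact: compact_setX.
have vY : cvxset Y.
  move=> y1 y2 t [O11 O12] [O21 O22] t0 t1.
  by split; apply: cvxset_Omega.
have g_aff y1 y2 t x :
    g ((1 - t) *: y1 + t *: y2) x = (1 - t) * g y1 x + t * g y2 x.
  by rewrite /g !peval_hpoly_affine; ring.
have g_cont x : continuous (g^~ x).
  have c1 : continuous (fun y : T => peval (hpoly y.1) x).
    move=> y; pose p1 y1 := peval (@hpoly R n (f (numix m)) y1) x.
    apply: (@cvg_comp _ _ _ fst p1 _ (nbhs y.1)).
      exact: cvg_fst.
    exact: peval_hpoly_continuous.
  have c2 : continuous (fun y : T => peval (hpoly y.2) x).
    move=> y; pose p2 y2 := peval (@hpoly R n (f (denix m)) y2) x.
    apply: (@cvg_comp _ _ _ snd p2 _ (nbhs y.2)).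
      exact: cvg_snd.
    exact: peval_hpoly_continuous.
  move=> y; apply: (@continuousD _ _ _ (fun y : T => peval (hpoly y.1) x)
    (fun y : T => theta * peval (hpoly y.2) x) y); first exact: c1.
  apply: (@continuousM _ _ (fun=> theta) (fun y : T => peval (hpoly y.2) x) y).
    exact: cst_continuous.
  exact: c2.
have g_sub (y : T) x : Y y ->
    exists u, forall x', g y x + dotrv u (x' - x) <= g y x'.
  move=> [Oy1 Oy2].
  have [u1 h1] := hpoly_subgradient hf x Oy1.
  have [u2 h2] := hpoly_subgradient hf x Oy2.
  exists (u1 + theta *: u2) => x'; rewrite /g dotrvDl dotrvZl.
  by have := h1 x'; have := ler_wpM2l th0 (h2 x'); lra.
have g_pos x : (forall c, cone_rV f c -> dotrv (slice x) c <= 0) ->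
    forall e, 0 < e -> exists2 y, Y y & - e < g y x.
  move=> /(FPset_polar hf)/pos Kx e e0.
  have [y1 [Oy1 f1 _]] := sossa_fun_attained (hf (numix m)) x.
  have [y2 [Oy2 f2 _]] := sossa_fun_attained (hf (denix m)) x.
  exists (y1, y2) => //; rewrite /g /= -f1 -f2.
  by apply: lt_le_trans Kx; rewrite oppr_lt0.
have [y [u [r [[Oy1 Oy2] /cone_rVP[ys [lam [Oys lam0 hc]]] gy]]]] :=
  cone_alternative (closed_cone_rV ccl) (cvxcone_cone_rV hf) cY vY g_aff g_cont
    g_sub ((FPset_polar hf x0).2 Kx0) g_pos.
exists ys, lam, y.1, y.2; split=> // x.
(* The constraint part of the Lagrangian lies above the affine function <x, u> - r, and g above its
   negative. *)
have := hc x; have := gy x; rewrite /g dotrv_slice mxE; lra.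
Qed.

(** The products of the multipliers with y^i and z^i become the variables of the relaxation, in
    which the Lagrangian and the scaled matrix inequalities are linear; X is a Gram matrix of the
    nonnegative Lagrangian. *)
Lemma Qhat_of_multipliers theta : 0 <= theta -> FPset f !=set0 ->
  closed (epicone f) ->
  (forall x, FPset f x ->
     0 <= sossa_fun (f (numix m)) x + theta * sossa_fun (f (denix m)) x) ->
  exists lam0 lam z X, @Qhatfeas R n d m f lam0 lam z X /\ theta = lam0 (denix m).
Proof.
move=> th0 K0 ccl pos.
have [y [lam [y1 [y2 [Oy O1 O2 h]]]]] := fractional_multipliers th0 K0 ccl pos.
pose q (i : 'I_(m + 2)) := match split i with
  | inl j => lam j *: hpoly (y j)
  | inr j => if j == ord0 then hpoly y1 else theta *: hpoly y2 end.
pose w (i : 'I_(m + 2)) := match split i with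
  | inl j => lam j | inr j => if j == ord0 then 1 else theta end.
have qc i : q (cix i) = lam i *: hpoly (y i).
  by rewrite /q (unsplitK (inl i)).
have qn : q (numix m) = hpoly y1 by rewrite /q (unsplitK (inr ord0)).
have qd : q (denix m) = theta *: hpoly y2 by rewrite /q (unsplitK (inr ord_max)).
have wc i : w (cix i) = lam i by rewrite /w (unsplitK (inl i)).
have wn : w (numix m) = 1 by rewrite /w (unsplitK (inr ord0)).
have wd : w (denix m) = theta by rewrite /w (unsplitK (inr ord_max)).
pose P i (yz : 'rV[R]_(sdim (f i)) * 'rV[R]_(pdim (f i))) :=
  q i = w i *: h0 (f i) + \sum_j yz.1 ord0 j *: hcoef (f i) j /\
  psdmx (w i *: A0 (f i) + \sum_j yz.1 ord0 j *: Acoef (f i) j +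
    \sum_l yz.2 ord0 l *: Bcoef (f i) l).
have scaled i (yi : 'rV[R]_(sdim (f i))) : Omega (f i) yi ->
    q i = w i *: hpoly yi -> 0 <= w i -> exists yz, P i yz.
  move=> [z pz] qi wi; exists (w i *: yi, w i *: z); split=> /=.
    rewrite qi /hpoly scalerDr scaler_sumr; congr (_ + _).
    by apply: eq_bigr => j _; rewrite mxE scalerA.
  rewrite (_ : _ + _ + _ = w i *: lmi yi z); first exact: psdmxZ.
  rewrite /lmi !scalerDr !scaler_sumr.
  by congr (_ + _ + _); apply: eq_bigr => j _; rewrite mxE scalerA.
have exP i : exists yz, P i yz.
  move: i; apply: ix_ind => [i||].
  - by have [Oi li] := Oy i; apply: scaled Oi _ _; rewrite ?wc // qc.
  - by apply: scaled O1 _ _; rewrite wn // scale1r qn.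
  - by apply: scaled O2 _ _; rewrite wd.
have qsos i : sos_convex (q i).
  move: i; apply: ix_ind => [i||].
  - have [Oi li] := Oy i; rewrite qc; apply: sos_convexZ => //.
    by have [_ hc _ _ _] := hf (cix i); exact: hc.
  - by rewrite qn; have [_ hc _ _ _] := hf (numix m); exact: hc.
  - rewrite qd; apply: sos_convexZ => //.
    by have [_ hc _ _ _] := hf (denix m); exact: hc.
have qsize i : (msize (q i) <= (2 * d).+1)%N.
  move: i; apply: ix_ind => [i||].
  - by rewrite qc; apply: leq_trans (msizeZ_le _ _) _; exact: msize_hpoly.
  - by rewrite qn; exact: msize_hpoly.
  - by rewrite qd; apply: leq_trans (msizeZ_le _ _) _; exact: msize_hpoly.
have [|||X pX XE] := @sos_convex_gram R n d (\sum_i q i).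
- by apply: msize_sum_le => i _; exact: qsize.
- exact: sos_convex_sum.
- move=> x; have := h (\row_k x k).
  have E p : peval p (\row_k x k) = p.@[x] by apply: meval_eq => k; rewrite mxE.
  rewrite sum_ix !mevalD qn qd mevalZ raddf_sum /=.
  under [X in _ -> 0 <= X + _ + _]eq_bigr do rewrite qc mevalZ.
  by under eq_bigr do rewrite E; rewrite !E.
pose yz i := sval (cid (exP i)).
have yzP i : P i (yz i) := svalP (cid (exP i)).
exists w, (fun i => (yz i).1), (fun i => (yz i).2), X; split=> //.
split=> // [a|i|].
- rewrite XE raddf_sum; apply: eq_bigr => i _ /=; have [-> _] := yzP i.
  rewrite mcoeffD mcoeffZ raddf_sum; congr (_ + _).
  by apply: eq_bigr => j _; rewrite /= mcoeffZ.
- by have [] := yzP i.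
- by split=> [i|]; rewrite ?wc ?wd //; have [] := Oy i.
Qed.

End ExactRelaxation.

Theorem theorem3p2 (R : realType) (n d m : nat)
    (f : 'I_(m + 2) -> sossa_data R n)
    (hf : forall i, sossa_ok d (f i))
    (hK : FPset f !=set0)
    (hnum : forall x, FPset f x -> 0 <= sossa_fun (f (numix m)) x)
    (hden : forall x, FPset f x -> 0 < - sossa_fun (f (denix m)) x)
    (hclosed : closed (epicone f))
    (hslater : forall i, exists (y : 'rV[R]_(sdim (f i)))
                                (z : 'rV[R]_(pdim (f i))), pdmx (lmi y z)) :
  infFP f = supQhat d f /\ supQhat d f = infQ d f /\
  forall (y : {ffun expo n (2 * d) -> R})
         (Z : forall i, 'M[R]_(tdim (f i))),
    is_minimizer (@Qset R n d m f) (@Qobj R n d m f) (y, Z) ->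
    y bm0 != 0 ->
    is_minimizer (FPset f) (FPobj f)
      ((y bm0)^-1 *: \row_(k < n) Lfun y 'X_k).
Proof.
have FP_Qhat : (infFP f <= supQhat d f)%E.
  have FP0 : (0 <= infFP f)%E.
    apply: le_ereal_inf_tmp => _ [x Kx <-]; rewrite lee_fin.
    by apply: divr_ge0; [exact: hnum|exact/ltW/hden].
  have FPle x : FPset f x -> (infFP f <= (FPobj f x)%:E)%E.
    by move=> Kx; apply: ereal_inf_lbound; exists x.
  have [x0 Kx0] := hK.
  have FPfin : infFP f \is a fin_num.
    by rewrite ge0_fin_numE // (le_lt_trans (FPle _ Kx0)) // ltry.
  set theta := fine (infFP f).
  have thE : infFP f = theta%:E by rewrite fineK.
  have th0 : 0 <= theta by rewrite -lee_fin -thE.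
  rewrite thE; apply: ereal_sup_ubound.
  (* Multiplying the bound on the ratio by -f_{m+2}(x) > 0 removes the fraction. *)
  have pos x : FPset f x ->
      0 <= sossa_fun (f (numix m)) x + theta * sossa_fun (f (denix m)) x.
    move=> Kx; have := FPle x Kx; rewrite thE lee_fin /FPobj.
    by rewrite ler_pdivlMr ?hden // mulrN; lra.
  have [lam0 [lam [z [X [feas ->]]]]] := Qhat_of_multipliers hf th0 hK hclosed pos.
  by exists lam0, lam, z, X.
have Qhat_Q : (supQhat d f <= infQ d f)%E.
  apply: ge_ereal_sup => _ [lam0 [lam [z [X [feas ->]]]]].
  apply: le_ereal_inf_tmp => _ [[y Z] Qw <-]; rewrite lee_fin.
  exact: Q_weak_duality Qw feas.
have Q_FP : (infQ d f <= infFP f)%E.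
  apply: le_ereal_inf_tmp => _ [x Kx <-].
  have [w [Qw <-]] := FP_point_in_Q hf hslater Kx (hden _ Kx).
  by apply: ereal_inf_lbound; exists w.
split; first by apply/eqP; rewrite eq_le FP_Qhat (le_trans Qhat_Q).
split; first by apply/eqP; rewrite eq_le Qhat_Q (le_trans Q_FP).
by move=> y Z ymin y0; exact: Q_minimizer_recovery ymin y0.
Qed.
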